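(* Let $\mathbf{K}$ be an abstract elementary class, $\lambda\geq\mathrm{LS}(\mathbf{K})$ such that $\mathbf{K}$ is stable in $\lambda$ and $\mathbf{K}_\lambda$ has the amalgamation property, and $\kappa<\lambda^+$ regular. Let $\mathbf{K}'$ be an abstract class with $\mathbf{K}_{(\lambda,\geq\kappa)}\subseteq\mathbf{K}'\subseteq\mathbf{K}_\lambda$. Let $\downarrow$ be an independence relation on $\mathbf{K}'$ satisfying weak uniqueness, weak extension, universal continuity* in $\mathbf{K}_\lambda$, $(\geq\kappa)$-local character, and $(\lambda,\theta)$-weak non-forking amalgamation for some regular $\theta\in[\kappa,\lambda^+)$. Then every $M\in\mathbf{K}_{(\lambda,\geq\kappa)}$ is a disjoint amalgamation base in $\mathbf{K}$.
   Context: An abstract class (AC) is a pair $(K,\leq_{\mathbf{K}})$ with $K$ a class of structures closed under isomorphism and $\leq_{\mathbf{K}}$ a partial order refining substructure and respected by isomorphisms. $\mathbf{K}_\lambda$: models of cardinality $\lambda$. $\mathrm{gtp}(a/M,N)$ is the Galois type (computed in $\mathbf{K}_\lambda$), $\mathrm{gS}(M)$ the set of Galois types over $M$; $p\subseteq q$ for $p\in\mathrm{gS}(M)$, $q\in\mathrm{gS}(M')$, $M\leq M'$, means $q\restriction M=p$. Stable in $\lambda$: $|\mathrm{gS}(M)|\leq\lambda$ for all $M\in\mathbf{K}_\lambda$. For $M\leq_{\mathbf{K}}N$ in $\mathbf{K}_\lambda$, $M\leq^u_{\mathbf{K}}N$ ($N$ universal over $M$) if every $N'\in\mathbf{K}_\lambda$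 with $M\leq_{\mathbf{K}}N'$ embeds into $N$ over $M$. For limit $\delta<\lambda^+$, $N$ is a $(\lambda,\delta)$-limit model over $M$ if there is $\langle M_i:i\leq\delta\rangle$ in $\mathbf{K}_\lambda$ with $M_i\leq^u_{\mathbf{K}}M_j$ for $i<j\leq\delta$, $M_0=M$, $M_\delta=\bigcup_{i<\delta}M_i=N$. $\mathbf{K}_{(\lambda,\geq\kappa)}$ is the AC of models that are $(\lambda,\delta)$-limit models over some model for some limit $\delta<\lambda^+$ with $\mathrm{cf}(\delta)\geq\kappa$. An independence relation on $\mathbf{K}'$ is a relation $a\downarrow^N_{M_0}M$ on $(M_0,a,M,N)$ with $M_0\leq M\leq N$ in $\mathbf{K}'$, $a\in N$, which is isomorphism invariant, monotone (if $a\downarrow^N_{M_0}M$ and $M_0\leq M_1\leq M\leq N_1\leq N\leq N_2$ in $\mathbf{K}'$ with $a\in N_1$ then $a\downarrow^{N_2}_{M_0}M_1$ and $a\downarrow^{N_1}_{M_0}M_1$) and base monotone (if $M_0\leq M_1\leq M$ then $a\downarrow^N_{M_1}M$). $p\in\mathrm{gS}(M)$ does not fork over $M_0$ if $p=\mathrm{gtp}(a/M,N)$ with $a\downarrow^N_{M_0}M$. All models below lie in $\mathbf{K}'$. Weak uniqueness: if $M_0\leq^u_{\mathbf{K}}M\leq N$, $p_1,p_2\in\mathrm{gS}(N)$ do not fork over $M_0$ and $p_1\restriction M=p_2\restriction M$ then $p_1=p_2$. Weak extension: if $M_0\leq^u_{\mathbf{K}}M\leq N$ and $p\in\mathrm{gS}(M)$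 does not fork over $M_0$, there is $q\in\mathrm{gS}(N)$ not forking over $M_0$ with $q\restriction M=p$. $(\geq\kappa)$-local character: if $\mathrm{cf}(\delta)\geq\kappa$, $\langle M_i:i\leq\delta\rangle$ is $\leq^u_{\mathbf{K}}$-increasing with $M_\delta=\bigcup_{i<\delta}M_i$ and $p\in\mathrm{gS}(M_\delta)$, then $p$ does not fork over some $M_i$, $i<\delta$. Universal continuity* in $\mathbf{K}_\lambda$: whenever $\delta$ is limit, $\langle M_i:i<\delta\rangle$ is $\leq^u_{\mathbf{K}}$-increasing in $\mathbf{K}'$ with $\bigcup_{i<\delta}M_i\in\mathbf{K}_\lambda$, $M\in\mathbf{K}'$ with $M_i\leq_{\mathbf{K}}M$ for all $i$, and $\langle p_i:i<\delta\rangle$ increasing with $p_i\in\mathrm{gS}(M_i)$ not forking over $M_i$, there is a unique $p\in\mathrm{gS}(\bigcup_{i<\delta}M_i)$ with $p_i\subseteq p$ for all $i$. $(\lambda,\theta)$-weak non-forking amalgamation: whenever $M_0,M,M_1,M_2\in\mathbf{K}'$, $M$ is a $(\lambda,\theta)$-limit model over $M_0$, $M\leq M_l$, $a_l\in M_l$ and $\mathrm{gtp}(a_l/M,M_l)$ does not fork over $M_0$ ($l=1,2$), there exist $N\in\mathbf{K}'$ and $f_l:M_l\to N$ fixing $M$ with $\mathrm{gtp}(f_l(a_l)/f_{3-l}[M_{3-l}],N)$ not forking over $M_0$ for $l=1,2$. $M$ is a disjoint amalgamation base in $\mathbf{K}$ if for all $M_1,M_2\in\mathbf{K}$ of cardinality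 $\|M\|$ with $M\leq_{\mathbf{K}}M_l$ there exist $N\in\mathbf{K}$ and embeddings $f_l:M_l\to N$ fixing $M$ with $f_1[M_1]\cap f_2[M_2]=M$. *)

(* Defs.v *)
From mathcomp Require Import all_boot all_classical wochoice.
From Stdlib Require Import Relations.Relation_Operators.
Set Implicit Arguments.
Unset Strict Implicit.
Unset Printing Implicit Defensive.
Local Open Scope classical_set_scope.
Local Open Scope card_scope.

(* Ordinals are represented by well-ordered types, cardinals by types compared
   with [#<=]; a cardinal that is also used as an ordinal (such as kappa and
   theta) is a well-ordered type satisfying [initial]. *)
Record woset := Woset {
  wo_sort :> Type;
  wo_le : rel wo_sort;
  wo_leP : well_order wo_le }.

Definition wo_lt (I : woset) (i j : I) : Prop := ~~ wo_le j i.

Definition limit_ordinal (I : woset) : Prop :=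
  (exists i : I, True) /\ forall i : I, exists j : I, wo_lt i j.

Definition cofinal (I : woset) (A : set I) : Prop :=
  forall i : I, exists2 j, A j & wo_le i j.

(* cf(I) >= |k|, where cf(I) is the least cardinality of a cofinal subset *)
Definition cf_ge (I : woset) (k : Type) : Prop :=
  forall A : set I, cofinal A -> [set: k] #<= A.

Definition initial (k : woset) : Prop :=
  forall i : k, ~~ ([set: k] #<= [set j : k | wo_lt j i]).

Definition regular_cardinal (k : woset) : Prop :=
  [/\ initial k, [set: nat] #<= [set: k] & cf_ge k k].

Record language := Language {
  fsym : Type;
  far : fsym -> nat;
  rsym : Type;
  rar : rsym -> nat }.

Section Structures.
Context (L : language) (U : Type).

(* Structures have as universe a subset of a type U of points, which plays the
   role of the universe of sets: it lets substructures, unions of chains and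
   intersections of models be taken literally.  U is arbitrary; when it has more
   than lam points, every structure of cardinality lam has isomorphic copies
   inside U, also over a given substructure.  Function symbols are interpreted
   by their graphs, so that a structure carries no information outside its
   universe and two structures with the same universe and interpretations are
   equal. *)
Record structure := Structure {
  dom : set U;
  fn : forall f : fsym L, ('I_(far f) -> U) -> U -> Prop;
  rl : forall r : rsym L, ('I_(rar r) -> U) -> Prop;
  fn_dom : forall f x y, fn (f := f) x y -> (forall k, dom (x k)) /\ dom y;
  fn_fun : forall f (x : 'I_(far f) -> U),
    (forall k, dom (x k)) -> exists! y, fn x y;
  rl_dom : forall r x, rl (r := r) x -> forall k, dom (x k) }.

Definition substructure (M N : structure) : Prop :=
  [/\ dom M `<=` dom N,
      forall f (x : 'I_(far f) -> U) y,
        (forall k, dom M (x k)) -> (fn M x y <-> fn N x y)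
    & forall r (x : 'I_(rar r) -> U),
        (forall k, dom M (x k)) -> (rl M x <-> rl N x)].

(* Maps between structures are restrictions of total maps U -> U; only the
   values on the universe of the source matter.  [iso h M N] also says that N is
   the image h[M]. *)
Definition iso (h : U -> U) (M N : structure) : Prop :=
  [/\ set_bij (dom M) (dom N) h,
      forall f (x : 'I_(far f) -> U) y, (forall k, dom M (x k)) -> dom M y ->
        (fn M x y <-> fn N (h \o x) (h y))
    & forall r (x : 'I_(rar r) -> U),
        (forall k, dom M (x k)) -> (rl M x <-> rl N (h \o x))].

Definition fixes (h : U -> U) (M : structure) : Prop :=
  forall x, dom M x -> h x = x.

Definition is_union (I : Type) (Ms : I -> structure) (N : structure) : Prop :=
  [/\ dom N = \bigcup_i dom (Ms i),
      forall f (x : 'I_(far f) -> U) y, fn N x y <-> exists i, fn (Ms i) x y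
    & forall r (x : 'I_(rar r) -> U), rl N x <-> exists i, rl (Ms i) x].

Record abstract_class := AbstractClass {
  ac_mem :> structure -> Prop;
  ac_le : structure -> structure -> Prop;
  ac_le_mem : forall M N, ac_le M N -> ac_mem M /\ ac_mem N;
  ac_le_refl : forall M, ac_mem M -> ac_le M M;
  ac_le_trans : forall M N P, ac_le M N -> ac_le N P -> ac_le M P;
  ac_le_anti : forall M N, ac_le M N -> ac_le N M -> M = N;
  ac_le_sub : forall M N, ac_le M N -> substructure M N;
  ac_mem_iso : forall h M N, iso h M N -> ac_mem M -> ac_mem N;
  ac_le_iso : forall h M N M' N',
    ac_le M N -> iso h N N' -> iso h M M' -> ac_le M' N' }.

(* The class K1 is contained in K2 and ordered by the restriction of the
   ordering of K2. *)
Definition sub_abstract_class (K1 K2 : abstract_class) : Prop :=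
  (forall M, K1 M -> K2 M) /\
  (forall M N, K1 M -> K1 N -> (ac_le K1 M N <-> ac_le K2 M N)).

Definition embedding (K : abstract_class) (h : U -> U) (M N : structure) : Prop :=
  exists2 M', iso h M M' & ac_le K M' N.

Definition LS_bound (K : abstract_class) (mu : Type) : Prop :=
  [/\ [set: nat] #<= [set: mu],
      [set: (fsym L + rsym L)%type] #<= [set: mu]
    & forall M (A : set U), K M -> A `<=` dom M ->
        exists M0, [/\ ac_le K M0 M, A `<=` dom M0
                     & dom M0 #<= [set: (A + mu)%type]]].

(* mu = LS(K) *)
Definition LS_number (K : abstract_class) (mu : Type) : Prop :=
  LS_bound K mu /\ forall nu : Type, LS_bound K nu -> [set: mu] #<= [set: nu].

Record abstract_elementary_class (K : abstract_class) : Prop := {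
  aec_coherence : forall M0 M1 M2,
    ac_le K M0 M2 -> ac_le K M1 M2 -> substructure M0 M1 -> ac_le K M0 M1;
  aec_chain : forall (I : woset) (Ms : I -> structure) N,
    limit_ordinal I -> (forall i j, wo_lt i j -> ac_le K (Ms i) (Ms j)) ->
    is_union Ms N -> K N /\ forall i, ac_le K (Ms i) N;
  aec_smooth : forall (I : woset) (Ms : I -> structure) N P,
    limit_ordinal I -> (forall i j, wo_lt i j -> ac_le K (Ms i) (Ms j)) ->
    is_union Ms N -> (forall i, ac_le K (Ms i) P) -> ac_le K N P;
  aec_LS : exists mu : Type, LS_number K mu }.

Definition disjoint_amalgamation_base (K : abstract_class) (M : structure) : Prop :=
  K M /\
  forall M1 M2, dom M1 #= dom M -> dom M2 #= dom M ->
    ac_le K M M1 -> ac_le K M M2 ->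
    exists N f1 f2,
      [/\ embedding K f1 M1 N /\ fixes f1 M,
          embedding K f2 M2 N /\ fixes f2 M
        & (f1 @` dom M1) `&` (f2 @` dom M2) = dom M].

Section FixedCardinal.
Context (K : abstract_class) (lam : Type).

Definition K_lam (M : structure) : Prop := K M /\ dom M #= [set: lam].

Definition amalgamation_lam : Prop :=
  forall M0 M1 M2, K_lam M0 -> K_lam M1 -> K_lam M2 ->
    ac_le K M0 M1 -> ac_le K M0 M2 ->
    exists N f1 f2,
      [/\ K_lam N, embedding K f1 M1 N /\ fixes f1 M0
        & embedding K f2 M2 N /\ fixes f2 M0].

(* (a, N) is a pair such that gtp(a/M, N) makes sense in K_lam. *)
Definition pretype (M : structure) (x : U * structure) : Prop :=
  [/\ K_lam M, K_lam x.2, ac_le K M x.2 & dom x.2 x.1].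

Definition gtp_atomic (M : structure) (x y : U * structure) : Prop :=
  [/\ pretype M x, pretype M y
    & exists N f g,
        [/\ K_lam N, embedding K f x.2 N /\ fixes f M,
            embedding K g y.2 N /\ fixes g M & f x.1 = g y.1]].

Definition gtp_equiv (M : structure) : U * structure -> U * structure -> Prop :=
  clos_trans (U * structure) (gtp_atomic M).

Definition gtp (a : U) (M N : structure) : set (U * structure) :=
  [set y | gtp_equiv M (a, N) y].

Definition gS (M : structure) : set (set (U * structure)) :=
  [set p | exists a N, pretype M (a, N) /\ p = gtp a M N].

(* The restriction to M of a type over some N >= M: by [restr_gtp] below it maps
   gtp(a/N, P) to gtp(a/M, P). *)
Definition restr (M : structure) (p : set (U * structure)) : set (U * structure) :=
  [set y | exists2 x, p x & gtp_equiv M x y].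

Definition stable_lam : Prop :=
  forall M, K_lam M -> gS M #<= [set: lam].

Definition universal (M N : structure) : Prop :=
  [/\ K_lam M, K_lam N, ac_le K M N
    & forall N', K_lam N' -> ac_le K M N' ->
        exists h, embedding K h N' N /\ fixes h M].

(* A chain indexed by i <= I is given by its members below I and its last
   member N. *)
Definition universal_chain (I : woset) (Ms : I -> structure) (N : structure) : Prop :=
  [/\ forall i j, wo_lt i j -> universal (Ms i) (Ms j),
      forall i, universal (Ms i) N
    & is_union Ms N].

Definition limit_model (I : woset) (M N : structure) : Prop :=
  [/\ limit_ordinal I, [set: I] #<= [set: lam]
    & exists Ms : I -> structure,
        universal_chain Ms N /\
        forall i, (forall j, wo_le i j) -> Ms i = M].

(* The models of the class K_(lam, >= k). *)
Definition K_limit (k : woset) (N : structure) : Prop :=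
  exists (I : woset) (M : structure), cf_ge I k /\ limit_model I M N.

Section Independence.
Context (K' : abstract_class) (ind : structure -> U -> structure -> structure -> Prop).

(* [ind M0 a M N] is the relation "a is independent from M over M0 in N". *)
Record independence_relation : Prop := {
  ind_dom : forall M0 a M N,
    ind M0 a M N -> [/\ ac_le K' M0 M, ac_le K' M N & dom N a];
  ind_iso : forall h M0 a M N M0' M' N', ind M0 a M N ->
    iso h N N' -> iso h M M' -> iso h M0 M0' -> ind M0' (h a) M' N';
  ind_mono : forall M0 a M N M1 N1 N2, ind M0 a M N ->
    ac_le K' M0 M1 -> ac_le K' M1 M -> ac_le K' M N1 -> ac_le K' N1 N ->
    ac_le K' N N2 -> dom N1 a -> ind M0 a M1 N2 /\ ind M0 a M1 N1;
  ind_base_mono : forall M0 a M N M1, ind M0 a M N ->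
    ac_le K' M0 M1 -> ac_le K' M1 M -> ind M1 a M N }.

(* p, a type over M, does not fork over M0. *)
Definition nonforking (M0 M : structure) (p : set (U * structure)) : Prop :=
  exists a N, ind M0 a M N /\ p = gtp a M N.

Definition weak_uniqueness : Prop :=
  forall M0 M N p1 p2, K' M0 -> universal M0 M -> ac_le K' M N ->
    gS N p1 -> gS N p2 -> nonforking M0 N p1 -> nonforking M0 N p2 ->
    restr M p1 = restr M p2 -> p1 = p2.

Definition weak_extension : Prop :=
  forall M0 M N p, K' M0 -> universal M0 M -> ac_le K' M N ->
    gS M p -> nonforking M0 M p ->
    exists q, [/\ gS N q, nonforking M0 N q & restr M q = p].

Definition local_character (k : woset) : Prop :=
  forall (I : woset) (Ms : I -> structure) N p,
    limit_ordinal I -> cf_ge I k ->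
    (forall i, K' (Ms i)) -> K' N -> universal_chain Ms N -> gS N p ->
    exists i, nonforking (Ms i) N p.

Definition universal_continuity_star : Prop :=
  forall (I : woset) (Ms : I -> structure) (Mu M : structure)
      (ps : I -> set (U * structure)),
    limit_ordinal I ->
    (forall i, K' (Ms i)) ->
    (forall i j, wo_lt i j -> universal (Ms i) (Ms j)) ->
    is_union Ms Mu -> K_lam Mu ->
    K' M -> (forall i, ac_le K (Ms i) M) ->
    (forall i, gS (Ms i) (ps i)) ->
    (forall i j, wo_lt i j -> restr (Ms i) (ps j) = ps i) ->
    (forall i, nonforking (Ms i) (Ms i) (ps i)) ->
    exists! p, gS Mu p /\ forall i, restr (Ms i) p = ps i.

Definition weak_nonforking_amalgamation (theta : woset) : Prop :=
  forall M0 M M1 M2 a1 a2,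
    K' M0 -> K' M -> K' M1 -> K' M2 ->
    limit_model theta M0 M -> ac_le K' M M1 -> ac_le K' M M2 ->
    dom M1 a1 -> dom M2 a2 ->
    nonforking M0 M (gtp a1 M M1) -> nonforking M0 M (gtp a2 M M2) ->
    exists N f1 f2 M1' M2',
      [/\ [/\ iso f1 M1 M1', ac_le K' M1' N & fixes f1 M],
          [/\ iso f2 M2 M2', ac_le K' M2' N & fixes f2 M],
          nonforking M0 M2' (gtp (f1 a1) M2' N)
        & nonforking M0 M1' (gtp (f2 a2) M1' N)].

End Independence.
End FixedCardinal.

Lemma restr_gtp (K : abstract_class) (lam : Type) M N P a :
  K_lam K lam M -> ac_le K M N -> pretype K lam N (a, P) ->
  restr K lam M (gtp K lam a N P) = gtp K lam a M P.
Proof.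
move=> KM MN pNaP.
have fixMN h : fixes h N -> fixes h M.
  by move=> fN x Mx; apply: fN; have [sub _ _] := ac_le_sub MN; apply: sub.
have pre x : pretype K lam N x -> pretype K lam M x.
  by case=> _ Kx Nx ax; split=> //; apply: ac_le_trans Nx.
have lift x y : gtp_atomic K lam N x y -> gtp_atomic K lam M x y.
  case=> px py [Q [f [g [KQ [ef ff] [eg fg] e]]]].
  split; [exact: pre | exact: pre | exists Q, f, g].
  by split=> //; split=> //; exact: fixMN.
have liftE x y : gtp_equiv K lam N x y -> gtp_equiv K lam M x y.
  elim=> [{}x {}y /lift xy|{}x {}y z _ xy _ yz]; first exact: t_step.
  exact: t_trans xy yz.
rewrite /restr /gtp; apply/seteqP; split=> y /=.
  by case=> x /liftE ax xy; apply: t_trans xy.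
move=> ay; exists (a, P) => //; apply: t_step; split=> //.
have [_ KP _ _] := pNaP.
have idP : iso id P P.
  by split=> //; split=> // x Px; exists x.
have PP : embedding K id P P by exists P => //; apply: ac_le_refl; case: KP.
by exists P, id, id.
Qed.

End Structures.

(* Main.v *)
Require Import Defs.
From mathcomp Require Import all_boot all_classical wochoice.
From Stdlib Require Import Relations.Relation_Operators.
Set Implicit Arguments.
Unset Strict Implicit.
Unset Printing Implicit Defensive.
Local Open Scope classical_set_scope.
Local Open Scope card_scope.

(* Work inside a model C of size lam^+ which is model-homogeneous for submodels
   of size lam.  A tower is an increasing family of models (M_x) indexed by a
   well-order together with elements a_x, lying in every later model, whose types
   over M_x do not fork over a fixed base.  A tower can be enlarged so that
   each M_x becomes a universal extension and the a_x remain nonforking over the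
   new M_x; weak extension and weak uniqueness suffice for this, and at unions of
   short chains of towers, which may leave K', universal continuity* does.
   Iterating along I x lam, where I is the length of the given limit model M, one
   (1) chooses new elements a_x realizing the nonforking types over the models of
   the tower, and (2) lets a point of the tower enter the bottom model whenever
   some further extension allows it.  By (1) and local character, the union N of
   the final tower is universal over its bottom model A; by (2), the bottom model
   M_* of any further extension meets N exactly in A.  As A is a limit model of
   length I starting above the same model as M, it is isomorphic to M, and any two
   extensions of M can be embedded in M_* and N. *)

(** * Cardinal arithmetic *)

(** Nonforking is maintained over the levels of single towers; over the union of a short chain of
    towers only equality of types is claimed. The a_x are given before the larger levels exist, so
    the levels cannot simply be enlarged around them. The tower is moved instead: once a new level
    m_y is chosen, a_y is sent to a point independent from m_y, and at the end everything is pulled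
    back. In I x lam, the factor I supplies the cofinality for local character and a chain of length
    I with union A to be compared with M; the lam steps for each point of I leave time to try all of
    the at most lam points that have appeared before. The positions of a tower form blocks, again
    indexed by I x lam: the union over time of the bottom models of a block realizes all types over
    the same union for an earlier block, and lam such steps give universality over A. *)

Lemma card_leTP (T V : Type) :
  [set: T] #<= [set: V] <-> exists f : T -> V, injective f.
Proof.
split=> [/card_leP[f]|[f fI]].
  have xT (x : T) : [set: T] x by [].
  exists (fun x => set_val (f (SigSub (mem_set (xT x))))) => x y /val_inj.
  by move/(@inj _ _ _ f); rewrite !in_setT => /(_ isT isT) [].
have /injfunPex[g] : exists2 f : T -> V, set_fun [set: T] [set: V] f
  & set_inj [set: T] f by exists f => // x y _ _; exact: fI.
exact: inj_card_le.
Qed.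

Lemma card_leTtype (T V : Type) (A : set T) :
  A #<= [set: V] <-> [set: A] #<= [set: V].
Proof. by rewrite (card_le_eql (card_setT A)). Qed.

Lemma card_le_set (T V : Type) (A : set T) (v0 : V) :
  A #<= [set: V] -> exists f : T -> V, {in A &, injective f}.
Proof.
move=> /card_leTtype/card_leTP[f fI].
exists (fun x => if pselect (A x) is left Ax then f (SigSub (mem_set Ax)) else v0).
move=> x y /set_mem Ax /set_mem Ay /=.
case: pselect => // {}Ax; case: pselect => // {}Ay /fI.
by move=> /(congr1 set_val).
Qed.

Lemma card_le_inj (T V : Type) (A : set T) (B : set V) (f : T -> V) :
  (forall x, A x -> B (f x)) -> {in A &, injective f} -> A #<= B.
Proof.
move=> fAB fI; have /injfunPex[g] : exists2 f : T -> V, set_fun A B f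
  & set_inj A f by exists f.
exact: inj_card_le.
Qed.

Lemma total_bigcup_cases (T : Type) (F : set (set T)) (x y : T) :
  total_on F subset -> (\bigcup_(X in F) X) x -> (\bigcup_(X in F) X) y ->
  exists X, [/\ F X, X x & X y].
Proof.
move=> Ft [X FX Xx] [Y FY Yy]; have [XY|YX] := Ft _ _ FX FY.
  by exists Y; split=> //; exact: XY.
by exists X; split=> //; exact: YX.
Qed.

(** A maximal graph of a partial injection is total or onto, since a pair of uncovered points could
    be added to it. *)
Lemma card_le_total (T V : Type) :
  [set: T] #<= [set: V] \/ [set: V] #<= [set: T].
Proof.
pose P (G : set (T * V)) := forall p q, G p -> G q -> (p.1 = q.1) <-> (p.2 = q.2).
have [G [PG Gmax]] : exists G, P G /\ forall H, G `<` H -> ~ P H.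
  apply: Zorn_bigcup => F FP Ft p q Fp Fq.
  by have [X [/FP PX Xp Xq]] := total_bigcup_cases Ft Fp Fq; exact: PX.
have [tot|/existsNP[x nx]] := pselect (forall x, exists y, G (x, y)).
  left; apply/card_leTP; have [f fG] := choice tot.
  by exists f => x y e; apply/(PG _ _ (fG x) (fG y)).
have [sur|/existsNP[y ny]] := pselect (forall y, exists x, G (x, y)).
  right; apply/card_leTP; have [f fG] := choice sur.
  by exists f => y z e; apply/(PG _ _ (fG y) (fG z)).
exfalso; apply: (Gmax (G `|` [set (x, y)])).
  rewrite properEneq; split; last by left.
  apply/eqP => e; apply: nx; exists y.
  by rewrite e; right.
move=> [p1 p2] [q1 q2] [Gp|/= [-> ->]] [Gq|/= [-> ->]] //=; first exact: (PG _ _ Gp Gq).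
  by split=> e; exfalso; [apply: nx; exists p2 | apply: ny; exists p1]; rewrite -e.
by split=> e; exfalso; [apply: nx; exists q2 | apply: ny; exists q1]; rewrite e.
Qed.

(* Zorn's lemma for the graphs of injections A * A -> A, A a subset of L,
   extending a given one with A countable; if the complement of A had a part
   equipotent to A, a maximal graph could be extended there. *)
Lemma card_square (L : Type) : [set: nat] #<= [set: L] ->
  exists f : L * L -> L, injective f.
Proof.
move=> /card_leTP[e eI].
have /card_leTP[pr prI] : [set: nat * nat] #<= [set: nat].
  by have := card_nat2; rewrite card_eq_le => /andP[].
pose dm (G : set (L * L * L)) (a : L) := exists c, G (a, a, c).
pose V (G : set (L * L * L)) := [/\ forall a b c, G (a, b, c) -> [/\ dm G a, dm G b & dm G c],
  forall a b, dm G a -> dm G b -> exists c, G (a, b, c)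
  & forall p q, G p -> G q -> p.1 = q.1 <-> p.2 = q.2].
pose G0 : set (L * L * L) :=
  [set p | exists m n, p = (e m, e n, e (pr (m, n)))].
have dm0 a : dm G0 a <-> exists n, a = e n.
  split; first by case=> c [m [n [-> _ _]]]; exists m.
  by case=> n ->; exists (e (pr (n, n))), n, n.
have V0 : V G0.
  split.
  - by move=> a b c [m [n [-> -> ->]]]; split; apply/dm0; eexists.
  - by move=> a b /dm0[m ->] /dm0[n ->]; exists (e (pr (m, n))), m, n.
  - move=> _ _ [m [n ->]] [m' [n' ->]] /=; split; first by case=> /eI-> /eI->.
    by move=> /eI/prI[-> ->].
(* [G0] is adjoined to every graph so that the empty chain satisfies the hypothesis of Zorn's
   lemma. *)
have [G [VG Gmax]] : exists G, V (G0 `|` G) /\ forall H, G `<` H -> ~ V (G0 `|` H).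
  apply: Zorn_bigcup => F FP Ft; rewrite /V.
  set H := _ `|` _.
  have [F0|/set0P[X0 FX0]] := eqVneq F set0.
    by rewrite /H F0 bigcup_set0 setU0.
  have HX p : H p -> exists X, F X /\ (G0 `|` X) p.
    by case=> [Gp|[X FX Xp]]; [exists X0; split=> //; left|exists X; split=> //; right].
  have XH X : F X -> G0 `|` X `<=` H.
    by move=> FX p [Gp|Xp]; [left|right; exists X].
  have HXX p q : H p -> H q -> exists X, [/\ F X, (G0 `|` X) p & (G0 `|` X) q].
    move=> /HX[X [FX Xp]] /HX[Y [FY Yq]]; have [XY|YX] := Ft _ _ FX FY.
      by exists Y; split=> //; apply: setUS Xp.
    by exists X; split=> //; apply: setUS Yq.
  have dmH X a : F X -> dm (G0 `|` X) a -> dm H a.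
    by move=> FX [c Xc]; exists c; apply: XH Xc.
  split.
  - move=> a b c /HX[X [FX Xp]]; have [V1 _ _] := FP _ FX.
    by have [] := V1 _ _ _ Xp; split; apply: dmH FX _.
  - move=> a b [c Hc] [d Hd]; have [X [FX Xc Xd]] := HXX _ _ Hc Hd.
    have [_ V2 _] := FP _ FX.
    have [|| z Xz] := V2 a b; [by exists c|by exists d|exists z; exact: XH Xz].
  - move=> p q Hp Hq; have [X [FX Xp Xq]] := HXX _ _ Hp Hq.
    by have [_ _ V3] := FP _ FX; exact: V3.
set H := G0 `|` G in VG; have [V1 V2 V3] := VG.
pose A : set L := dm H.
have AG0 n : A (e n) by exists (e (pr (n, n))); left; exists n, n.
have /choice[phi phiP] : forall p : L * L, exists c, A p.1 -> A p.2 -> H (p, c).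
  move=> [a b]; have [[Aa Ab]|nA] := pselect (A a /\ A b).
    by have [c Hc] := V2 _ _ Aa Ab; exists c.
  by exists a => Aa Ab; case: nA.
have phiI p q : A p.1 -> A p.2 -> A q.1 -> A q.2 -> phi p = phi q -> p = q.
  by move=> *; apply/(V3 (p, phi p) (q, phi q)) => //; exact: phiP.
have phiA p : A p.1 -> A p.2 -> A (phi p).
  by case: p => a b Aa Ab; have [] := V1 _ _ _ (phiP (a, b) Aa Ab).
(* Pairs with first entry [e 0] and pairs with first entry [e 1] give two disjoint copies of [A]
   inside [A]: one receives [A], the other [Q]. *)
have doubling (Q : set L) (r : L -> L) :
    (forall x, Q x -> A (r x)) ->
    (forall x y, Q x -> Q y -> r x = r y -> x = y) -> (forall x, Q x -> ~ A x) ->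
    exists psi : L -> L, (forall x, A x \/ Q x -> A (psi x)) /\
      forall x y, A x \/ Q x -> A y \/ Q y -> psi x = psi y -> x = y.
  move=> rA rI QA.
  exists (fun x => if pselect (A x) then phi (e 0, x) else phi (e 1, r x)); split.
    by move=> x; case: pselect => [Ax|nA] [] // Qx; apply: phiA => //=; exact: rA.
  move=> x y; case: pselect => Ax; case: pselect => Ay //.
  - by move=> _ _ /phiI /= -/(_ (AG0 0) Ax (AG0 0) Ay)[].
  - by move=> _ [//|Qy] /phiI /= -/(_ (AG0 0) Ax (AG0 1) (rA _ Qy))[/eI].
  - by move=> [//|Qx] _ /phiI /= -/(_ (AG0 1) (rA _ Qx) (AG0 0) Ay)[/eI].
  - move=> [//|Qx] [//|Qy] /phiI /= -/(_ (AG0 1) (rA _ Qx) (AG0 1) (rA _ Qy))[].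
    exact: rI.
(* If the complement embeds into [A], doubling embeds all of [L] into [A], and [phi] becomes an
   injection on [L * L]. Otherwise [A] has a copy outside itself; sending the new pairs into that
   copy contradicts maximality. *)
have [] := card_le_total (~` A) A.
  move=> /card_leTP[f fI].
  pose r x := if pselect ((~` A) x) is left nA then set_val (f (SigSub (mem_set nA)))
              else x.
  have [||//|psi [psiA psiI]] := @doubling (~` A) r.
  - by move=> x nA; rewrite /r; case: pselect => // ?; exact: set_valP.
  - move=> x y nx ny; rewrite /r; case: pselect => // px; case: pselect => // py.
    by move=> /val_inj/fI/(congr1 set_val).
  exists (fun p => phi (psi p.1, psi p.2)) => [[a b] [c d]] /=.
  have AC x : A x \/ (~` A) x by case: (pselect (A x)); [left|right].
  move=> /phiI /= -/(_ (psiA _ (AC a)) (psiA _ (AC b)) (psiA _ (AC c)) (psiA _ (AC d))).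
  by move=> [/psiI-> // /psiI->].
move=> /card_leTP[f fI]; exfalso.
pose j x := if pselect (A x) is left Ax then set_val (f (SigSub (mem_set Ax))) else x.
have jA x : A x -> ~ A (j x).
  by move=> Ax; rewrite /j; case: pselect => // {}Ax; exact: (set_valP (f _)).
have jI x y : A x -> A y -> j x = j y -> x = y.
  move=> Ax Ay; rewrite /j; case: pselect => // px; case: pselect => // py.
  by move=> /val_inj/fI/(congr1 set_val).
have /choice[k kP] : forall y, exists x, (j @` A) y -> A x /\ j x = y.
  move=> y; have [[x Ax <-]|ny] := pselect ((j @` A) y); first by exists x.
  by exists y.
have [|||psi [psiA psiI]] := @doubling (j @` A) k.
- by move=> x /kP[].
- by move=> x y /kP[_ e1] /kP[_ e2] e3; rewrite -e1 -e2 e3.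
- by move=> _ [x Ax <-]; exact: jA.
pose E x := A x \/ (j @` A) x.
pose H' : set (L * L * L) := H `|` [set p | [/\ E p.1.1, E p.1.2, ~ (A p.1.1 /\ A p.1.2)
    & p.2 = j (phi (psi p.1.1, psi p.1.2))]].
have dmH' a : dm H' a <-> E a.
  split.
    by case=> c [Hc|[]//]; left; exists c.
  have [Aa _|nA Ea] := pselect (A a); first by have [c Hc] := Aa; exists c; left.
  by exists (j (phi (psi a, psi a))); right; split=> //=; case.
apply: (Gmax H').
  rewrite properEneq; split; last by move=> p Gp; left; right.
  apply/eqP => eG; have : H' (j (e 0), j (e 0), j (phi (psi (j (e 0)), psi (j (e 0))))).
    have Ej : E (j (e 0)) by right; exists (e 0).
    by right; split=> //=; case=> /(jA _ (AG0 0)).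
  rewrite -eG => Gp; have : A (j (e 0)) by eexists; right; exact: Gp.
  exact: jA.
have -> : G0 `|` H' = H' by apply/setUidPr => p Gp; left; left.
split.
- move=> a b c [/V1[Aa Ab Ac]|[/= Ea Eb _ ->]]; first by split; apply/dmH'; left.
  split; apply/dmH' => //; right; exists (phi (psi a, psi b)) => //.
  by apply: phiA; exact: psiA.
- move=> a b /dmH' Ea /dmH' Eb.
  have [[Aa Ab]|nA] := pselect (A a /\ A b).
    by have [c Hc] := V2 _ _ Aa Ab; exists c; left.
  by exists (j (phi (psi a, psi b))); right.
have key a b c a' b' c' : H (a, b, c) -> E a' -> E b' -> ~ (A a' /\ A b') ->
    c' = j (phi (psi a', psi b')) -> ((a, b) = (a', b')) <-> c = c'.
  move=> Hp Ea Eb nA ec; have [Aa Ab Ac] := V1 _ _ _ Hp.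
  split=> [[ea eb]|e1]; first by case: nA; rewrite -ea -eb.
  exfalso; apply: (@jA (phi (psi a', psi b'))); last by rewrite -ec -e1.
  by apply: phiA; exact: psiA.
move=> [[a b] c] [[a' b'] c'] [Hp|/= [/= Ea Eb nA ec]] [Hq|/= [/= Ea' Eb' nA' ec']].
- exact: V3.
- exact: key.
- split=> /esym h; apply/esym; move: h; first by move/(key _ _ _ _ _ _ Hq Ea Eb nA ec).
  by move=> h; apply/(key _ _ _ _ _ _ Hq Ea Eb nA ec).
- rewrite ec ec'; split=> [[-> ->]//|/jI].
  have phA x y : E x -> E y -> A (phi (psi x, psi y)).
    by move=> Ex Ey; apply: phiA; exact: psiA.
  move=> /(_ (phA _ _ Ea Eb) (phA _ _ Ea' Eb'))/phiI /=.
  move=> /(_ (psiA _ Ea) (psiA _ Eb) (psiA _ Ea') (psiA _ Eb')).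
  by move=> [/psiI-> // /psiI->].
Qed.

Lemma card_le_prod (L X Y : Type) : [set: nat] #<= [set: L] ->
  [set: X] #<= [set: L] -> [set: Y] #<= [set: L] -> [set: X * Y] #<= [set: L].
Proof.
move=> /card_square[f fI] /card_leTP[g gI] /card_leTP[h hI]; apply/card_leTP.
by exists (fun p => f (g p.1, h p.2)) => -[a b] [c d] /fI[/gI-> /hI->].
Qed.

Lemma card_le_bigcup (L X T : Type) (F : X -> set T) : [set: nat] #<= [set: L] ->
  [set: X] #<= [set: L] -> (forall x, F x #<= [set: L]) ->
  \bigcup_x F x #<= [set: L].
Proof.
move=> infL; have [f fI] := card_square infL; move: infL => /card_leTP[n _].
move=> /card_leTP[g gI] FL; have /choice[h hI] := fun x => card_le_set (n 0) (FL x).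
have [|/existsNP[x0 _]] := pselect (forall x : X, False).
  by move=> nX; rewrite bigcup0 ?card_ge0 // => x; case: (nX x).
have /choice[k kP] : forall t, exists x, (\bigcup_x F x) t -> F x t.
  move=> t; have [[x _ Fxt]|nt] := pselect ((\bigcup_x F x) t); first by exists x.
  by exists x0.
apply: (@card_le_inj _ _ _ _ (fun t => f (g (k t), h (k t) t))) => //.
move=> s t /set_mem/kP Fs /set_mem/kP Ft /fI[/gI ek].
by rewrite -ek; apply: hI; apply: mem_set => //; rewrite ek.
Qed.

Lemma card_leU (L T : Type) (A B : set T) : [set: nat] #<= [set: L] ->
  A #<= [set: L] -> B #<= [set: L] -> A `|` B #<= [set: L].
Proof.
move=> infL AL BL.
have -> : A `|` B = \bigcup_b (fun b : bool => if b then A else B) b.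
  apply/seteqP; split=> x; first by case=> ?; [exists true|exists false].
  by case=> -[] _ ?; [left|right].
apply: card_le_bigcup => //; last by case.
have /card_leTP[g gI] := infL.
by apply/card_leTP; exists (fun b : bool => g b) => -[] [] // /gI.
Qed.

Lemma card_le_setC (L T : Type) (A : set T) : [set: nat] #<= [set: L] ->
  ~~ ([set: T] #<= [set: L]) -> A #<= [set: L] -> [set: L] #<= ~` A.
Proof.
move=> infL /negP nT AL.
have [|CL] := card_le_total L (~` A); first by rewrite (card_le_eqr (card_setT _)).
exfalso; apply: nT; have <- : A `|` ~` A = setT by exact: setUv.
by apply: card_leU => //; apply/card_leTtype.
Qed.

(** * Well-ordered types *)

Section WosetTheory.
Context {I : woset}.
Implicit Types (i j k : I) (P : I -> Prop).

(** [well_order] only provides a unique least element in each nonempty set; reflexivity, totality,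
    antisymmetry and transitivity are derived below from sets with at most three elements. *)
Lemma wo_min P : (exists i, P i) -> exists i, P i /\ forall j, P j -> wo_le i j.
Proof.
case=> i Pi; have [|z [[zP zm] _]] := @wo_leP I [pred i | `[< P i >]].
  by exists i; apply/asboolP.
by exists z; split=> [|j Pj]; [exact/asboolP|apply: zm; apply/asboolP].
Qed.

Lemma wo_refl i : wo_le i i.
Proof. by have [_ [-> h]] := @wo_min (eq^~ i) (ex_intro _ i erefl); exact: h. Qed.

Lemma wo_total i j : wo_le i j \/ wo_le j i.
Proof.
have [|k [[->|->] h]] := @wo_min (fun k => k = i \/ k = j); first by exists i; left.
  by left; apply: (h j); right.
by right; apply: (h i); left.
Qed.

Lemma wo_anti i j : wo_le i j -> wo_le j i -> i = j.
Proof.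
move=> ij ji; have [|k [_ U]] := @wo_leP I [pred k | `[< k = i \/ k = j >]].
  by exists i; apply/asboolP; left.
have ki : k = i.
  by apply: U; split=> [|l /asboolP[->|->]]; [apply/asboolP; left|exact: wo_refl|].
by rewrite -ki; apply: U; split=> [|l /asboolP[->|->]];
  [apply/asboolP; right| |exact: wo_refl].
Qed.

Lemma wo_le_trans j i k : wo_le i j -> wo_le j k -> wo_le i k.
Proof.
move=> ij jk.
have [|l [[->|[->|->]] h]] := @wo_min (fun l => l = i \/ l = j \/ l = k).
- by exists i; left.
- by apply: h; auto.
- by rewrite (@wo_anti i j) //; apply: h; auto.
- by rewrite -(@wo_anti j k) //; apply: h; auto.
Qed.

Lemma wo_ltP i j : wo_lt i j <-> ~ wo_le j i.
Proof. by split=> /negP. Qed.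

Lemma wo_ltW i j : wo_lt i j -> wo_le i j.
Proof. by move=> /wo_ltP ji; case: (wo_total i j). Qed.

Lemma wo_lt_irr i : ~ wo_lt i i.
Proof. by move=> /wo_ltP; apply; exact: wo_refl. Qed.

Lemma wo_le_lt_trans j i k : wo_le i j -> wo_lt j k -> wo_lt i k.
Proof.
by move=> ij /wo_ltP jk; apply/wo_ltP => ki; apply: jk; exact: wo_le_trans ki ij.
Qed.

Lemma wo_lt_le_trans j i k : wo_lt i j -> wo_le j k -> wo_lt i k.
Proof.
by move=> /wo_ltP ij jk; apply/wo_ltP => ki; apply: ij; exact: wo_le_trans jk ki.
Qed.

Lemma wo_lt_trans j i k : wo_lt i j -> wo_lt j k -> wo_lt i k.
Proof. by move=> /wo_ltW; exact: wo_le_lt_trans. Qed.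

Lemma wo_leVlt i j : wo_le i j \/ wo_lt j i.
Proof.
have [|n] := pselect (wo_le i j : Prop); first by left.
by right; apply/wo_ltP.
Qed.

Lemma wo_le_eqVlt i j : wo_le i j -> i = j \/ wo_lt i j.
Proof.
by move=> ij; have [ji|] := wo_leVlt j i; [left; exact: wo_anti|right].
Qed.

Lemma wo_lt_neq i j : wo_lt i j -> i <> j.
Proof. by move=> ij e; move: ij; rewrite e; exact: wo_lt_irr. Qed.

Lemma wo_ind P : (forall i, (forall j, wo_lt j i -> P j) -> P i) -> forall i, P i.
Proof.
move=> H i; apply: contrapT => nPi.
have [|j [nPj jm]] := @wo_min (fun i => ~ P i); first by exists i.
apply: nPj; apply: H => k kj; apply: contrapT => /jm jk.
by apply: (@wo_lt_irr j); apply: wo_le_lt_trans kj.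
Qed.

Definition wo_succ_of i j := wo_lt i j /\ forall k, wo_lt k j -> wo_le k i.

Lemma wo_succ_ex i : (exists j, wo_lt i j) -> exists j, wo_succ_of i j.
Proof.
move=> /wo_min[j [ij jm]]; exists j; split=> // k kj.
have [//|/jm jk] := wo_leVlt k i.
by case: (@wo_lt_irr j); exact: wo_le_lt_trans kj.
Qed.

Lemma wo_succ_le i j k : wo_succ_of i j -> wo_lt i k -> wo_le j k.
Proof.
move=> [ij jm] ik; have [//|/jm ki] := wo_leVlt j k.
by case: (@wo_lt_irr i); exact: wo_lt_le_trans ki.
Qed.

(** Zero, successor, limit. In the limit case each [j] comes with its successor [k], because the
    recursions below settle the task of [j] at a stage strictly after [j]. *)
Lemma wo_cases i : [\/ forall j, wo_le i j, exists j, wo_succ_of j i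
  | (exists j, wo_lt j i) /\
    forall j, wo_lt j i -> exists2 k, wo_succ_of j k & wo_lt k i].
Proof.
have [[j ji]|n] := pselect (exists j, wo_lt j i); last first.
  by apply: Or31 => j; have [//|ji] := wo_leVlt i j; case: n; exists j.
have [sc|nsc] := pselect (exists j, wo_succ_of j i); first exact: Or32.
apply: Or33; split; first by exists j.
move=> {ji}j ji; have [|k jk] := @wo_succ_ex j; first by exists i.
exists k => //; have := wo_succ_le jk ji => /wo_le_eqVlt[e|//].
by case: nsc; exists j; rewrite -e.
Qed.

(* Definition by transfinite recursion of a sequence whose value at each step is
   only constrained relative to the previous values. *)
Lemma wo_rec (S : Type) (s0 : S) (P : (I -> S) -> I -> Prop) :
  (forall h h' i, (forall j, wo_le j i -> h j = h' j) -> P h i -> P h' i) ->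
  (forall h i, (forall j, wo_lt j i -> P h j) ->
    exists s, P (fun j => if `[< j = i >] then s else h j) i) ->
  exists h, forall i, P h i.
Proof.
move=> Ploc Pstep.
pose upd (h : I -> S) i s := fun j => if `[< j = i >] then s else h j.
(* A fixed choice function [st] makes the step deterministic, so that partial solutions ([ok]) agree
   on their common domain and can be glued. *)
have /choice[st stP] : forall hi : (I -> S) * I, exists s,
    (forall j, wo_lt j hi.2 -> P hi.1 j) -> P (upd hi.1 hi.2 s) hi.2.
  move=> [h i] /=; have [H|n] := pselect (forall j, wo_lt j i -> P h j).
    by have [s Ps] := Pstep h i H; exists s.
  by exists s0.
pose rst (h : I -> S) i := fun j => if `[< wo_lt j i >] then h j else s0.
pose ok i h := forall j, wo_le j i -> h j = st (rst h j, j).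
have rstE h h' i : (forall j, wo_lt j i -> h j = h' j) -> rst h i = rst h' i.
  by move=> e; apply/funext => j; rewrite /rst; case: asboolP => // /e.
have okU i h h' : ok i h -> ok i h' -> forall j, wo_le j i -> h j = h' j.
  move=> oh oh'; elim/wo_ind => j IH ji; rewrite oh // oh' //; congr (st (_, _)).
  by apply: rstE => k kj; apply: IH => //; exact: wo_le_trans (wo_ltW kj) ji.
have okle i j h : wo_le i j -> ok j h -> ok i h.
  by move=> ij oh k ki; apply: oh; exact: wo_le_trans ij.
have okE i : exists h, ok i h.
  elim/wo_ind: i => i IH.
  have /choice[hh hhP] : forall j, exists h, wo_lt j i -> ok j h.
    move=> j; have [/IH[h oh]|n] := pselect (wo_lt j i); first by exists h.
    by exists (fun=> s0).
  pose h0 j := hh j j.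
  have h0E j : wo_lt j i -> h0 j = st (rst h0 j, j).
    move=> ji; rewrite /h0 (hhP j ji j (wo_refl j)); congr (st (_, _)).
    apply: rstE => k kj; have ki := wo_lt_trans kj ji.
    apply: (okU k); [|exact: hhP|exact: wo_refl].
    exact: okle (wo_ltW kj) (hhP _ ji).
  exists (upd h0 i (st (rst h0 i, i))) => j ji.
  have rE : rst (upd h0 i (st (rst h0 i, i))) j = rst h0 j.
    apply: rstE => k kj; rewrite /upd; case: asboolP => // e.
    by case: (@wo_lt_irr i); apply: wo_lt_le_trans ji; rewrite -e.
  rewrite rE {1}/upd; case: asboolP => [->//|ne]; apply: h0E.
  by case: (wo_le_eqVlt ji).
have /choice[H HP] := okE; pose h i := H i i.
have hE i : h i = st (rst h i, i).
  rewrite /h (HP i i (wo_refl i)); congr (st (_, _)).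
  apply: rstE => j ji; apply: (okU j); [|exact: HP|exact: wo_refl].
  exact: okle (wo_ltW ji) (HP _).
exists h; elim/wo_ind => i IH.
have := stP (rst h i, i); rewrite -hE /= => st'.
apply: (Ploc _ _ _ _ (st' _)) => j ji.
  rewrite /upd; case: asboolP => [->//|ne].
  rewrite /rst; case: asboolP => // n; case: n.
  by case: (wo_le_eqVlt ji).
apply: (Ploc _ _ _ _ (IH _ ji)) => k kj; rewrite /rst; case: asboolP => // n; case: n.
exact: wo_le_lt_trans ji.
Qed.

End WosetTheory.

Lemma well_orderP (T : Type) (R : T -> T -> Prop) :
  (forall x y, R x y -> R y x -> x = y) ->
  (forall P : T -> Prop, (exists x, P x) -> exists x, P x /\ forall y, P y -> R x y) ->
  well_order (fun x y => `[< R x y >]).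
Proof.
move=> anti mn A [x Ax]; have [|z [Az zm]] := mn (fun x => x \in A).
  by exists x.
exists z; split; first by split=> // y /zm zy; apply/asboolP.
move=> y [Ay ym]; apply: anti; first exact: zm.
by apply/asboolP; exact: ym.
Qed.

Lemma woset_ex (T : Type) : exists I : woset, wo_sort I = T.
Proof.
have [R Rwo] := well_ordering_principle {classic T}.
by exists (@Woset T R Rwo).
Qed.

Section Sub.
Context (I : woset) (Q : I -> Prop).

Lemma wo_sub_subproof :
  well_order (fun x y : {i : I | Q i} => `[< wo_le (sval x) (sval y) >]).
Proof.
apply: (@well_orderP _ (fun x y : {i : I | Q i} => wo_le (sval x) (sval y))).
  by move=> [x Qx] [y Qy] /= xy yx; apply: eq_exist; exact: wo_anti.
move=> P [x Px]; have [|z [[z' [<- Pz']] zm]] := @wo_min I (fun i => exists x, sval x = i /\ P x).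
  by exists (sval x), x.
by exists z'; split=> // y Py; apply: zm; exists y.
Qed.

Definition wo_sub := Woset wo_sub_subproof.

Lemma wo_sub_leE (x y : wo_sub) : wo_le x y <-> wo_le (sval x) (sval y).
Proof. by split=> [/asboolP|?]; [|apply/asboolP]. Qed.

Lemma wo_sub_ltE (x y : wo_sub) : wo_lt x y <-> wo_lt (sval x) (sval y).
Proof. by rewrite !wo_ltP wo_sub_leE. Qed.

End Sub.

Section Lex.
Context (I J : woset).

Definition lex_le (x y : I * J) := wo_lt x.1 y.1 \/ x.1 = y.1 /\ wo_le x.2 y.2.

Lemma wo_lex_subproof : well_order (fun x y => `[< lex_le x y >]).
Proof.
apply: well_orderP => [[a b] [c d]|P [[a b] Pab]]; rewrite /lex_le /=.
  move=> [ac|[-> bd]] [ca|[e db]].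
  - by case: (@wo_lt_irr _ a); exact: wo_lt_trans ca.
  - by case: (wo_lt_neq ac).
  - by case: (@wo_lt_irr _ c).
  - by rewrite (@wo_anti _ b d).
have [|i [[j Pij] im]] := @wo_min I (fun i => exists j, P (i, j)).
  by exists a, b.
have [|k [Pik km]] := @wo_min J (fun j => P (i, j)); first by exists j.
exists (i, k); split=> // -[c d] Pcd /=.
have /im/wo_le_eqVlt[e|] : exists d, P (c, d) by exists d.
  by right; split=> //; apply: km; rewrite e.
by left.
Qed.

Definition wo_lex := Woset wo_lex_subproof.

Lemma wo_lex_ltE (x y : wo_lex) :
  wo_lt x y <-> wo_lt x.1 y.1 \/ x.1 = y.1 /\ wo_lt x.2 y.2.
Proof.
rewrite wo_ltP; split=> [n|].
  have [yx|] := wo_leVlt y.1 x.1; last by left.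
  case: (wo_le_eqVlt yx) => [e|yx']; last by exfalso; apply: n; apply/asboolP; left.
  by right; split=> //; apply/wo_ltP => yx2; apply: n; apply/asboolP; right.
move=> h /asboolP g; case: h g => [xy|[e xy]] [yx|[e' yx]].
- by case: (@wo_lt_irr _ x.1); exact: wo_lt_trans yx.
- by case: (wo_lt_neq xy); rewrite e'.
- by case: (wo_lt_neq yx); rewrite e.
- by case: (@wo_lt_irr _ x.2); exact: wo_lt_le_trans yx.
Qed.

Lemma wo_lex_limit : limit_ordinal I -> (exists j : J, True) ->
  limit_ordinal wo_lex.
Proof.
move=> [[i _] lim] [j _]; split; first by exists (i, j).
by move=> [a b]; have [c ac] := lim a; exists (c, b); apply/wo_lex_ltE; left.
Qed.

(** The first projection of a cofinal set is cofinal in [I]. *)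
Lemma wo_lex_cf_ge (k : Type) : (exists j : J, True) -> cf_ge I k -> cf_ge wo_lex k.
Proof.
move=> [j _] cfI A cofA; apply: (@card_le_trans _ _ _ (fst @` A)); last exact: card_image_le.
apply: cfI => i; have [[a b] Aab] := cofA (i, j).
move=> /asboolP h; exists a; first by exists (a, b).
by case: h => [|[/= -> _]]; [exact: wo_ltW|exact: wo_refl].
Qed.

End Lex.

Lemma wo_least (I : woset) : (exists i : I, True) -> exists i : I, forall j, wo_le i j.
Proof. by move=> /wo_min[i [_ im]]; exists i => j; exact: im. Qed.

Lemma wo_cof_limit (I : woset) (i : I) : limit_ordinal I -> exists j, wo_succ_of i j.
Proof. by case=> _ /(_ i); exact: wo_succ_ex. Qed.

(* The cardinal successor of L, as an initial segment of a well-ordering of T. *)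
Lemma successor_cardinal (L T : Type) : [set: nat] #<= [set: L] ->
  ~~ ([set: T] #<= [set: L]) -> exists I : woset,
  [/\ limit_ordinal I, forall i : I, [set j | wo_lt j i] #<= [set: L]
    & forall (A : set I), A #<= [set: L] -> exists i, forall j, A j -> wo_lt j i].
Proof.
move=> infL /negP nT.
(* If a set of size at most [L] were unbounded, [I] would be a union of at most [L] many initial
   segments, each of size at most [L]. *)
suff [I [nI sI]] : exists I : woset, ~ ([set: I] #<= [set: L]) /\
    forall i : I, [set j | wo_lt j i] #<= [set: L].
  have [l _] : exists l : L, True by have /card_leTP[f _] := infL; exists (f 0).
  have bd (A : set I) : A #<= [set: L] -> exists i, forall j, A j -> wo_lt j i.
    move=> /card_leTtype AL; apply: contrapT => nb; apply: nI.
    have -> : [set: I] = \bigcup_(a : A) ([set j | wo_lt j (set_val a)] `|` [set set_val a]).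
      apply/seteqP; split=> // i _; apply: contrapT => ni; apply: nb; exists i => j Aj.
      have [ij|//] := wo_leVlt i j; case: ni; exists (SigSub (mem_set Aj)) => //.
      by case: (wo_le_eqVlt ij) => ?; [right|left].
    apply: card_le_bigcup => // a; apply: card_leU => //.
    by apply: (@card_le_inj _ _ _ _ (fun=> l)) => // x y /set_mem-> /set_mem->.
  exists I; split=> //; split.
    apply: contrapT => n; apply: nI; apply/card_leTP.
    by exists (fun=> l) => i; case: n; exists i.
  move=> i; have [|j jP] := bd [set i]; last by exists j; exact: jP.
  by apply: (@card_le_inj _ _ _ _ (fun=> l)) => // x y /set_mem-> /set_mem->.
have [V VT] := woset_ex T.
have {nT}nV : ~ ([set: V] #<= [set: L]) by rewrite VT.
(* The well-ordering is cut at the first point with too large an initial segment, if there is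
   one. *)
have [[v nv]|sm] := pselect (exists v : V, ~ ([set j | wo_lt j v] #<= [set: L])); last first.
  exists V; split=> // i; apply: contrapT => n; apply: sm; by exists i.
have [v0 [nv0 vm]] := @wo_min V (fun v => ~ ([set j | wo_lt j v] #<= [set: L])) (ex_intro _ v nv).
exists (wo_sub (fun j => wo_lt j v0)); split.
  move=> /card_leTP[f fI]; apply: nv0; apply/card_leTtype/card_leTP.
  pose g (a : [set j | wo_lt j v0]) := f (exist _ (set_val a) (set_valP a)).
  by exists g => a b /fI[/val_inj].
move=> [i iv]; apply: contrapT => n.
have : wo_le v0 i.
  apply: vm => si; apply: n; apply: card_le_trans si.
  apply: (@card_le_inj _ _ _ _ sval).
    by move=> x /= /wo_sub_ltE.
  by move=> [x px] [y py] _ _ /= e; apply: eq_exist.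
by move=> /(wo_lt_le_trans iv); exact: wo_lt_irr.
Qed.

(** * Structures, isomorphic copies and unions of chains *)

Section StructureTheory.
Context (L : language) (U : Type).
Implicit Types (M N P : structure L U) (f g h : U -> U).

Lemma iso_id M : iso id M M.
Proof. by split=> //; split=> // x; exists x. Qed.

Lemma iso_fun h M N x : iso h M N -> dom M x -> dom N (h x).
Proof. by case=> -[hf _ _] _ _ /hf. Qed.

Lemma iso_inj h M N x y : iso h M N -> dom M x -> dom M y -> h x = h y -> x = y.
Proof. by case=> -[_ hi _] _ _ Mx My; apply: hi; apply: mem_set. Qed.

Lemma iso_dom h M N : iso h M N -> dom N = h @` dom M.
Proof.
case=> -[hf _ hs] _ _; apply/seteqP; split=> y; first by move=> /hs.
by case=> x Mx <-; exact: hf.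
Qed.

Lemma iso_comp f g M N P : iso f M N -> iso g N P -> iso (g \o f) M P.
Proof.
move=> iF iG; have [[f1 f2 f3] f4 f5] := iF; have [[g1 g2 g3] g4 g5] := iG.
split.
- split=> [x Mx|x y /set_mem Mx /set_mem My /= e|z Pz].
  + by apply: g1; exact: f1.
  + apply: (iso_inj iF) => //; apply: (iso_inj iG) => //; exact: f1.
  + by have [y /f3[x Mx <-] <-] := g3 _ Pz; exists x.
- move=> s x y Mx My; rewrite f4 // g4 //; first by move=> k; apply: f1.
  exact: f1.
- by move=> r x Mx; rewrite f5 // g5 // => k; apply: f1.
Qed.

Lemma iso_ext f g M N : (forall x, dom M x -> f x = g x) -> iso f M N -> iso g M N.
Proof.
move=> e iF; have [[f1 f2 f3] f4 f5] := iF; split.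
- split=> [x Mx|x y /set_mem Mx /set_mem My|z Nz].
  + by rewrite -e //; exact: f1.
  + by rewrite -!e //; exact: (iso_inj iF).
  + by have [x Mx <-] := f3 _ Nz; exists x; rewrite ?e.
- move=> s x y Mx My; rewrite f4 // e //.
  by have -> : f \o x = g \o x by apply/funext => k; rewrite /= e.
- move=> r x Mx; rewrite f5 //.
  by have -> : f \o x = g \o x by apply/funext => k; rewrite /= e.
Qed.

Lemma iso_inv h M N : iso h M N -> exists g, [/\ iso g N M,
  forall x, dom M x -> g (h x) = x & forall y, dom N y -> h (g y) = y].
Proof.
move=> iH; have [[h1 h2 h3] h4 h5] := iH.
have /choice[g gP] : forall y, exists x, dom N y -> dom M x /\ h x = y.
  move=> y; have [/h3[x Mx <-]|n] := pselect (dom N y); first by exists x.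
  by exists y.
have gh x : dom M x -> g (h x) = x.
  by move=> Mx; have [Mg e] := gP _ (h1 _ Mx); exact: (iso_inj iH).
have hg y : dom N y -> h (g y) = y by move=> /gP[].
have gM y : dom N y -> dom M (g y) by move=> /gP[].
exists g; split=> //; split.
- split=> // [x y /set_mem Nx /set_mem Ny e|x Mx]; first by rewrite -(hg x) // e hg.
  by exists (h x); [exact: h1|exact: gh].
- move=> s x y Nx Ny; rewrite h4 ?hg //; try by move=> k; exact: gM.
  by have -> : h \o (g \o x) = x by apply/funext => k; rewrite /= hg.
  exact: gM.
- move=> r x Nx; rewrite h5; last by move=> k; exact: gM.
  by have -> : h \o (g \o x) = x by apply/funext => k; rewrite /= hg.
Qed.

Lemma iso_image M h : {in dom M &, injective h} -> exists N, iso h M N.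
Proof.
move=> hI0.
have hI x y : dom M x -> dom M y -> h x = h y -> x = y.
  by move=> Mx My; apply: hI0; exact: mem_set.
pose fn' (s : Defs.fsym L) (x : 'I_(far s) -> U) y :=
  exists x' y', [/\ fn M x' y', x = h \o x' & y = h y'].
pose rl' (r : rsym L) (x : 'I_(rar r) -> U) := exists x', rl M x' /\ x = h \o x'.
have fnd s x y : fn' s x y -> (forall k, (h @` dom M) (x k)) /\ (h @` dom M) y.
  move=> [x' [y' [xy ex ey]]]; have [Mx My] := fn_dom xy; rewrite ex ey.
  by split=> [k|]; [exists (x' k)|exists y'].
have lft n (x : 'I_n -> U) : (forall k, (h @` dom M) (x k)) ->
    exists x', (forall k, dom M (x' k)) /\ x = h \o x'.
  move=> /(_ _)/cid2 c; exists (fun k => s2val (c k)); split.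
    by move=> k; exact: s2valP (c k).
  by apply/funext => k /=; rewrite (s2valP' (c k)).
have cmpI n (x y : 'I_n -> U) : (forall k, dom M (x k)) -> (forall k, dom M (y k)) ->
    h \o x = h \o y -> x = y.
  by move=> Mx My /funeqP e; apply/funext => k; apply: hI => //; exact: e.
have fnf s (x : 'I_(far s) -> U) :
    (forall k, (h @` dom M) (x k)) -> exists! y, fn' s x y.
  move=> /lft[x' [Mx ->]]; have [y [xy yU]] := fn_fun Mx.
  exists (h y); split; first by exists x', y.
  move=> z [x'' [z' [xz /cmpI e ->]]]; have [Mx'' _] := fn_dom xz.
  by rewrite (yU z') // e.
have rld r x : rl' r x -> forall k, (h @` dom M) (x k).
  by move=> [x' [rx ->]] k; exists (x' k) => //; exact: rl_dom rx k.
exists (Structure fnd fnf rld); split.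
- split=> [x Mx||]; [by exists x| |by move=> y [x Mx <-]; exists x].
  exact: hI0.
- move=> f x y Mx My; split=> [xy|[x' [y' [xy /cmpI e /hI ey]]]]; first by exists x, y.
  by have [Mx' My'] := fn_dom xy; rewrite e // ey.
- move=> r x Mx; split=> [rx|[x' [rx /cmpI e]]]; first by exists x.
  by rewrite e // => k; exact: rl_dom rx k.
Qed.

Lemma sub_sub M N P : substructure M P -> substructure N P -> dom M `<=` dom N ->
  substructure M N.
Proof.
move=> [_ Mf Mr] [_ Nf Nr] MN; split=> // [f x y Mx|r x Mx].
  by rewrite Mf // Nf // => k; exact: MN.
by rewrite Mr // Nr // => k; exact: MN.
Qed.

Lemma wo_bound_fin (I : woset) (i0 : I) n (F : 'I_n -> I) :
  exists i, forall k, wo_le (F k) i.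
Proof.
elim: n F => [|n IH] F; first by exists i0 => -[].
have [i iP] := IH (fun k => F (lift ord0 k)).
have [i0i|ii0] := wo_total (F ord0) i.
  by exists i => k; case: (unliftP ord0 k) => [j ->|->].
exists (F ord0) => k; case: (unliftP ord0 k) => [j ->|->]; last exact: wo_refl.
exact: wo_le_trans ii0.
Qed.

Lemma union_ex (I : woset) (i0 : I) (Ms : I -> structure L U) :
  (forall i j, wo_le i j -> substructure (Ms i) (Ms j)) -> exists N, is_union Ms N.
Proof.
move=> mono.
pose D := \bigcup_i dom (Ms i).
pose fn' (s : Defs.fsym L) (x : 'I_(far s) -> U) y := exists i, fn (Ms i) x y.
pose rl' (r : rsym L) (x : 'I_(rar r) -> U) := exists i, rl (Ms i) x.
(* Arities are finite, so a tuple from the union lies in one member of the chain. *)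
have lft n (x : 'I_n -> U) : (forall k, D (x k)) ->
    exists i, forall k, dom (Ms i) (x k).
  move=> Dx; have /choice[F FP] : forall k, exists i, dom (Ms i) (x k).
    by move=> k; have [i _ ?] := Dx k; exists i.
  have [i iP] := wo_bound_fin i0 F; exists i => k.
  by have [s _ _] := mono _ _ (iP k); exact: s.
have fnd s x y : fn' s x y -> (forall k, D (x k)) /\ D y.
  by move=> [i xy]; have [Dx Dy] := fn_dom xy; split; [move=> k|]; exists i.
have fnf s (x : 'I_(far s) -> U) : (forall k, D (x k)) -> exists! y, fn' s x y.
  move=> /lft[i Mx]; have [y [xy yU]] := fn_fun Mx.
  exists y; split; first by exists i.
  move=> z [j xz]; have [ij|ji] := wo_total i j.
    have [_ mf _] := mono _ _ ij; move/mf: xy => /(_ Mx) xy.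
    have [w [_ wU]] := fn_fun (proj1 (fn_dom xy)).
    by rewrite -(wU _ xy) -(wU _ xz).
  have [_ mf _] := mono _ _ ji; apply: yU; apply/mf => //.
  by have [] := fn_dom xz.
have rld r x : rl' r x -> forall k, D (x k).
  by move=> [i rx] k; exists i => //; exact: rl_dom rx k.
by exists (Structure fnd fnf rld).
Qed.

End StructureTheory.

(** * Embeddings, amalgamation and universal extensions *)

Section ClassTheory.
Context (L : language) (U : Type) (K : abstract_class L U).
Implicit Types (M N P D B Q : structure L U) (f g h : U -> U).

Lemma embedding_dom f M N x : embedding K f M N -> dom M x -> dom N (f x).
Proof.
by move=> [M' iM /ac_le_sub[s _ _]] Mx; apply: s; exact: iso_fun iM Mx.
Qed.

Lemma embedding_inj f M N x y : embedding K f M N -> dom M x -> dom M y ->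
  f x = f y -> x = y.
Proof. by move=> [M' iM _]; exact: iso_inj iM. Qed.

Lemma embedding_id M N : ac_le K M N -> embedding K id M N.
Proof. by exists M => //; exact: iso_id. Qed.

Lemma embedding_iso f M N : iso f M N -> K N -> embedding K f M N.
Proof. by exists N => //; exact: ac_le_refl. Qed.

Lemma embedding_ext f g M N : (forall x, dom M x -> f x = g x) ->
  embedding K f M N -> embedding K g M N.
Proof. by move=> e [M' iM le]; exists M' => //; exact: iso_ext iM. Qed.

Lemma embedding_le f M N P : embedding K f M N -> ac_le K N P -> embedding K f M P.
Proof. by move=> [M' iM le] NP; exists M' => //; exact: ac_le_trans le NP. Qed.

Lemma iso_le f M N P : iso f N P -> ac_le K M N ->
  exists2 M', iso f M M' & ac_le K M' P.
Proof.
move=> iN le; have [s _ _] := ac_le_sub le.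
have [|M' iM] := @iso_image _ _ M f.
  by move=> x y /set_mem Mx /set_mem My; apply: (iso_inj iN); exact: s.
by exists M' => //; exact: ac_le_iso le iN iM.
Qed.

Lemma embedding_sub f M N P : embedding K f N P -> ac_le K M N -> embedding K f M P.
Proof.
move=> [N' iN le] MN; have [M' iM le'] := iso_le iN MN.
by exists M' => //; exact: ac_le_trans le' le.
Qed.

Lemma embedding_comp f g M N P : embedding K f M N -> embedding K g N P ->
  embedding K (g \o f) M P.
Proof.
move=> [M' iM le] /embedding_sub/(_ le)[M'' iM' le'].
by exists M'' => //; exact: iso_comp iM iM'.
Qed.

Section AEC.
Context (lam : Type).
Context (U_large : ~~ ([set: U] #<= [set: lam])) (aecK : abstract_elementary_class K).
Context (lam_inf : [set: nat] #<= [set: lam]) (amalg : amalgamation_lam K lam).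
Local Notation Klam := (K_lam K lam).

Lemma Klam_le M : Klam M -> dom M #<= [set: lam].
Proof. by case=> _; rewrite card_eq_le => /andP[]. Qed.

Lemma Klam_ge M : Klam M -> [set: lam] #<= dom M.
Proof. by case=> _; rewrite card_eq_le => /andP[]. Qed.

Lemma Klam_intro M : K M -> dom M #<= [set: lam] -> [set: lam] #<= dom M -> Klam M.
Proof. by move=> KM h1 h2; split=> //; rewrite card_eq_le h1 h2. Qed.

Lemma Klam_iso h M N : iso h M N -> Klam M -> Klam N.
Proof.
move=> iH [KM cM]; split; first exact: ac_mem_iso iH KM.
rewrite (iso_dom iH); apply: card_eq_trans cM; apply: inj_card_eq => x y.
by move=> /set_mem Mx /set_mem My; exact: iso_inj iH Mx My.
Qed.

Lemma lam_inh : exists l : lam, True.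
Proof. by have /card_leTP[f _] := lam_inf; exists (f 0). Qed.

(* The complement of M has at least |lam| points, so the part of N outside the
   image of M can be moved there. *)
Lemma rename h M N : Klam M -> Klam N -> embedding K h M N ->
  exists N' g, [/\ iso g N N', ac_le K M N' & forall x, dom M x -> g (h x) = x].
Proof.
move=> KM KN [M' iM le]; have [hinv [iI hinvE hE]] := iso_inv iM.
have [l _] := lam_inh.
have /(card_le_set l)[c cI] := Klam_le KN.
have /card_leTP[e eI] : [set: lam] #<= [set: ~` dom M].
  by rewrite (card_le_eqr (card_setT _)); exact: card_le_setC (Klam_le KM).
have eC a : (~` dom M) (set_val (e a)) by exact: set_valP (e a).
pose g y := if pselect (dom M' y) then hinv y else set_val (e (c y)).
have gI : {in dom N &, injective g}.
  move=> x y Nx Ny; rewrite /g; case: pselect => M'x; case: pselect => M'y.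
  - exact: iso_inj iI M'x M'y.
  - by move=> /= e1; case: (eC (c y)); rewrite -e1; exact: iso_fun iI M'x.
  - by move=> /= e1; case: (eC (c x)); rewrite e1; exact: iso_fun iI M'y.
  - by move=> /val_inj/eI; exact: cI.
have [N' iN] := iso_image gI.
exists N', g; split=> //.
  have ge y : dom M' y -> hinv y = g y by move=> M'y; rewrite /g; case: pselect.
  exact: ac_le_iso le iN (iso_ext ge iI).
move=> x Mx; rewrite /g; case: pselect => [M'x|n] /=; first exact: hinvE.
by case: n; exact: iso_fun iM Mx.
Qed.

(** Amalgamation along an embedding instead of an inclusion: [B] is copied to an extension of the
    image of [D], amalgamated with [M] there, and the amalgam is renamed so that it literally
    contains [M]. *)
Lemma amalgam_ext f D B M : Klam D -> Klam B -> Klam M -> ac_le K D B ->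
  embedding K f D M ->
  exists N g, [/\ Klam N, ac_le K M N, embedding K g B N
    & forall x, dom D x -> g x = f x].
Proof.
move=> KD KB KM DB [D' iD le].
have [fi [iI fiE _]] := iso_inv iD.
have KD' := Klam_iso iD KD.
have [B' [k [iB D'B' kE]]] : exists B' k, [/\ iso k B B', ac_le K D' B'
    & forall x, dom D' x -> k (fi x) = x].
  by apply: rename => //; apply: embedding_le DB; exact: embedding_iso iI (proj1 KD).
have KB' := Klam_iso iB KB.
have [N [f1 [f2 [KN [e1 fix1] [e2 fix2]]]]] := amalg KD' KM KB' le D'B'.
have [N' [g [iN MN' gE]]] := rename KM KN e1.
exists N', (g \o (f2 \o k)); split=> //; first exact: Klam_iso iN KN.
  apply: embedding_comp (embedding_iso iN (proj1 (Klam_iso iN KN))).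
  exact: embedding_comp (embedding_iso iB (proj1 KB')) e2.
move=> x Dx /=; have D'f := iso_fun iD Dx.
have -> : k x = f x by rewrite -{1}(fiE _ Dx) kE.
rewrite fix2 // -{1}(fix1 _ D'f) gE //.
by have [s _ _] := ac_le_sub le; exact: s.
Qed.

(** The amalgam of [B] and [M] along [f] embeds into [Q] over [M]. *)
Lemma universal_ext f D B M Q : universal K lam M Q -> Klam D -> Klam B ->
  ac_le K D B -> embedding K f D M ->
  exists g, embedding K g B Q /\ forall x, dom D x -> g x = f x.
Proof.
move=> [KM KQ MQ uQ] KD KB DB ef.
have [N [g [KN MN eg gE]]] := amalgam_ext KD KB KM DB ef.
have [k [ek fk]] := uQ N KN MN.
exists (k \o g); split; first exact: embedding_comp eg ek.
by move=> x Dx /=; rewrite gE // fk //; exact: embedding_dom ef Dx.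
Qed.

Lemma universal_sub D M Q : Klam D -> ac_le K D M -> universal K lam M Q ->
  universal K lam D Q.
Proof.
move=> KD DM uQ; have [KM KQ MQ _] := uQ; split=> //; first exact: ac_le_trans DM MQ.
move=> N KN DN; have [g [eg gE]] := universal_ext uQ KD KN DN (embedding_id DM).
by exists g.
Qed.

Lemma chain_union (I : woset) (Ms : I -> structure L U) : (exists i : I, True) ->
  (forall i j, wo_lt i j -> ac_le K (Ms i) (Ms j)) -> (forall i, K (Ms i)) ->
  exists N, [/\ is_union Ms N, K N, forall i, ac_le K (Ms i) N
    & forall P, (forall i, ac_le K (Ms i) P) -> ac_le K N P].
Proof.
move=> [i0 _] mono KMs.
have mono' i j : wo_le i j -> ac_le K (Ms i) (Ms j).
  by move=> /wo_le_eqVlt[->|/mono//]; exact: ac_le_refl.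
have [lim|nlim] := pselect (limit_ordinal I).
  have [|N uN] := @union_ex _ _ I i0 Ms.
    by move=> i j /mono'; exact: ac_le_sub.
  have [KN MN] := aec_chain aecK lim mono uN.
  by exists N; split=> // P; exact: (aec_smooth aecK lim mono uN).
(* [aec_chain] speaks of limit lengths only; otherwise there is a last model, which is the union. *)
have [m mP] : exists m : I, forall i, wo_le i m.
  apply: contrapT => n; apply: nlim; split; first by exists i0.
  move=> i; apply: contrapT => n'; apply: n; exists i => j.
  by have [//|ij] := wo_leVlt j i; case: n'; exists j.
have sm i := ac_le_sub (mono' _ _ (mP i)).
exists (Ms m); split=> //; last by move=> i; exact: mono'.
split.
- apply/seteqP; split=> x; first by exists m.
  by case=> i _; have [s _ _] := sm i; exact: s.
- move=> f x y; split=> [xy|[i xy]]; first by exists m.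
  by have [_ mf _] := sm i; apply/mf => //; have [] := fn_dom xy.
- move=> r x; split=> [rx|[i rx]]; first by exists m.
  by have [_ _ mr] := sm i; apply/mr => //; exact: rl_dom rx.
Qed.

Lemma chain_union_lam (I : woset) (Ms : I -> structure L U) :
  (exists i : I, True) -> [set: I] #<= [set: lam] ->
  (forall i j, wo_lt i j -> ac_le K (Ms i) (Ms j)) -> (forall i, Klam (Ms i)) ->
  exists N, [/\ is_union Ms N, Klam N, forall i, ac_le K (Ms i) N
    & forall P, (forall i, ac_le K (Ms i) P) -> ac_le K N P].
Proof.
move=> [i0 _] Ilam mono KMs.
have [|//|i|N [uN KN MN NP]] := @chain_union I Ms; first by exists i0.
  by have [] := KMs i.
exists N; split=> //; have [dN _ _] := uN; apply: Klam_intro => //.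
  by rewrite dN; apply: card_le_bigcup => // i; exact: Klam_le.
apply: card_le_trans (Klam_ge (KMs i0)) _; rewrite dN.
by apply: subset_card_le => x; exists i0.
Qed.

(** * The monster model *)

Section Monster.
Context (K' : abstract_class L U) (subK : sub_abstract_class K' K)
  (K'lam : forall M, K' M -> Klam M).
Context (M0 M1 M : structure L U) (u01 : universal K lam M0 M1)
  (u1 : universal K lam M1 M) (K'M : K' M).

(** [D] embeds into [M1] over [M0], and [M] is universal over [M1]. Pulling [M] back along this
    embedding gives an extension of [D] that is isomorphic to [M], hence in [K']. *)
Lemma universal_cover D : Klam D -> ac_le K M0 D ->
  exists Q, K' Q /\ universal K lam D Q.
Proof.
move=> KD M0D; have [_ _ _ u] := u01; have [h [eh fh]] := u D KD M0D.
have [_ KM M1M _] := u1.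
have [Q [g [iQ DQ gE]]] := rename KD KM (embedding_le eh M1M).
have KQ := Klam_iso iQ KM.
exists Q; split; first exact: ac_mem_iso iQ K'M.
split=> // N KN DN; have [k [ek kE]] := universal_ext u1 KD KN DN eh.
exists (g \o k); split; first exact: embedding_comp (embedding_iso iQ (proj1 KQ)).
by move=> x Dx /=; rewrite kE // gE.
Qed.

(* A union of a chain of lam^+ models, each universal over the previous ones. *)
Lemma monster : exists C : structure L U, [/\ K C, ac_le K M C,
  forall f D B, Klam D -> Klam B -> ac_le K D B -> embedding K f D C ->
    exists g, embedding K g B C /\ forall x, dom D x -> g x = f x
  & forall A : set U, A `<=` dom C -> A #<= [set: lam] ->
    exists Q, [/\ K' Q, ac_le K Q C, A `<=` dom Q
      & forall P, Klam P -> ac_le K P C -> dom P `<=` A -> universal K lam P Q]].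
Proof.
have [O [limO segO bdO]] := successor_cardinal lam_inf U_large.
have [_ KM M1M _] := u1; have [_ _ M01 _] := u01.
have M0M := ac_le_trans M01 M1M.
pose Pr (h : O -> structure L U) i := [/\ K' (h i), ac_le K M (h i)
  & forall j, wo_lt j i -> universal K lam (h j) (h i)].
have [|h i H|h hP] := @wo_rec O _ M Pr.
- move=> h h' i e [p1 p2 p3]; rewrite /Pr -(e i) ?wo_refl //; split=> // j ji.
  by rewrite -e; [exact: p3|exact: wo_ltW].
- have [D [KD MD hD]] : exists D, [/\ Klam D, ac_le K M D
      & forall j, wo_lt j i -> ac_le K (h j) D].
    have [[j0 j0i]|n] := pselect (exists j, wo_lt j i); last first.
      exists M; split=> //; first by apply: ac_le_refl; case: KM.
      by move=> j ji; case: n; exists j.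
    pose S := wo_sub (fun j => wo_lt j i).
    have [||||N [_ KN hN _]] := @chain_union_lam S (fun s => h (sval s)).
    + by exists (exist _ j0 j0i).
    + apply: card_le_trans (segO i); apply: (@card_le_inj _ _ _ _ sval).
        by move=> x _; exact: (svalP x).
      by move=> [x px] [y py] _ _ /= e; apply: eq_exist.
    + move=> [a ai] [b bi] /wo_sub_ltE /= ab; have [_ _ /(_ a ab)[]] // := H b bi.
    + by move=> [a ai] /=; have [/K'lam] := H a ai.
    exists N; split=> //.
      have [_ M_ _] := H j0 j0i; exact: ac_le_trans M_ (hN (exist _ j0 j0i)).
    by move=> j ji; exact: (hN (exist _ j ji)).
  have [Q [K'Q uQ]] := universal_cover KD (ac_le_trans M0M MD).
  have [_ _ DQ _] := uQ.
  exists Q; rewrite /Pr; case: asboolP => // _; split=> //.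
    exact: ac_le_trans MD DQ.
  move=> j ji; case: asboolP => [e|_]; first by case: (wo_lt_neq ji).
  by apply: universal_sub (hD j ji) uQ; have [/K'lam] := H j ji.
have hlt i j : wo_lt i j -> universal K lam (h i) (h j).
  by move=> ij; have [_ _ ] := hP j; exact.
have Kh i : Klam (h i) by have [/K'lam] := hP i.
have [o0 _] : exists o : O, True by case: limO.
have [|i j /hlt[]//|i|C [[dC _ _] KC hC _]] := @chain_union O h; first by exists o0.
  by have [] := Kh i.
(* Every set of at most [lam] points of [C] lies in one stage, because such sets of indices are
   bounded in [O]. *)
have bound (A : set U) : A `<=` dom C -> A #<= [set: lam] ->
    exists i, A `<=` dom (h i).
  move=> AC Al; have /choice[r rP] : forall x, exists i, A x -> dom (h i) x.
    move=> x; have [/AC|n] := pselect (A x); last by exists o0.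
    by rewrite dC => -[i _ hx]; exists i.
  have [|i iP] := bdO (r @` A); first exact: card_le_trans (card_image_le _ _) Al.
  exists i => x Ax; have /iP/hlt[_ _ /ac_le_sub[s _ _] _] : (r @` A) (r x) by exists x.
  by apply: s; exact: rP.
have coh P i : ac_le K P C -> dom P `<=` dom (h i) -> ac_le K P (h i).
  move=> PC Pi; apply: (aec_coherence aecK PC (hC i)).
  exact: sub_sub (ac_le_sub PC) (ac_le_sub (hC i)) Pi.
exists C; split=> //.
- by have [_ M_ _] := hP o0; exact: ac_le_trans M_ (hC o0).
- move=> f D B KD KB DB [D' iD D'C].
  have KD' := Klam_iso iD KD.
  have [|i D'i] := bound (dom D') _ (Klam_le KD').
    by have [] := ac_le_sub D'C.
  have [j [ij _]] := wo_cof_limit i limO.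
  have ef : embedding K f D (h i) by exists D' => //; exact: coh.
  have [g [eg gE]] := universal_ext (hlt _ _ ij) KD KB DB ef.
  by exists g; split=> //; exact: embedding_le eg (hC j).
- move=> A AC Al; have [i Ai] := bound A AC Al.
  have [j [ij _]] := wo_cof_limit i limO.
  exists (h j); split=> //; first by have [] := hP j.
    by move=> x /Ai; have [_ _ /ac_le_sub[s _ _] _] := hlt _ _ ij; exact: s.
  move=> P KP PC PA; apply: universal_sub (hlt _ _ ij) => //; apply: coh => //.
  exact: subset_trans Ai.
Qed.

End Monster.
End AEC.
End ClassTheory.

(** * Small submodels of a monster model *)

Section MonsterModel.
Context (L : language) (U : Type) (K : abstract_class L U) (lam : Type).
Context (kappa : woset) (K' : abstract_class L U).
Context (ind : structure L U -> U -> structure L U -> structure L U -> Prop).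
Local Notation Klam := (K_lam K lam).
Context (U_large : ~~ ([set: U] #<= [set: lam])) (aecK : abstract_elementary_class K).
Context (lam_inf : [set: nat] #<= [set: lam]) (stable : stable_lam K lam)
  (amalg : amalgamation_lam K lam).
Context (subK : sub_abstract_class K' K)
  (K'limit : forall M, K_limit K lam kappa M -> K' M)
  (K'lam : forall M, K' M -> Klam M).
Context (indP : independence_relation K' ind) (wuniq : weak_uniqueness K lam K' ind)
  (wext : weak_extension K lam K' ind)
  (ucont : universal_continuity_star K lam K' ind)
  (locchar : local_character K lam K' ind kappa).
Context (C : structure L U)
  (C_ext : forall f D B, Klam D -> Klam B -> ac_le K D B -> embedding K f D C ->
    exists g, embedding K g B C /\ forall x, dom D x -> g x = f x)
  (C_cover : forall A : set U, A `<=` dom C -> A #<= [set: lam] ->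
    exists Q, [/\ K' Q, ac_le K Q C, A `<=` dom Q
      & forall P, Klam P -> ac_le K P C -> dom P `<=` A -> universal K lam P Q]).
Implicit Types (A B D E : set U) (M N P Q R : structure L U) (f g h : U -> U).

(* A submodel of C is determined by its universe, so that from here on the
   models of cardinality lam below C are treated as sets. *)
Definition mdl A P := [/\ ac_le K P C, Klam P & dom P = A].
Definition sm A := exists P, mdl A P.
Definition ks A := exists P, mdl A P /\ K' P.
Definition emb f A := exists P, mdl A P /\ embedding K f P C.
Definition univ A B := exists P Q, [/\ mdl A P, mdl B Q & universal K lam P Q].
(** Galois types in a homogeneous model are orbits; embeddings of small submodels over [A] take the
    place of automorphisms of [C]. See [gtp_eqtp]. *)
Definition eqtp A (a b : U) := exists B g,
  [/\ sm A, emb g B, A `<=` B, B a & (forall x, A x -> g x = x) /\ g a = b].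
(** The ambient model [R] is existential, so that this depends only on the type of [a] over [B]; see
    [nonforking_NF] and [NF_eqtp]. *)
Definition NF A (a : U) B := exists P Q R,
  [/\ mdl A P, mdl B Q, ac_le K R C & ind P a Q R].

Lemma mdl_le A B P Q : mdl A P -> mdl B Q -> A `<=` B -> ac_le K P Q.
Proof.
move=> [PC _ <-] [QC _ <-] AB; apply: (aec_coherence aecK PC QC).
exact: sub_sub (ac_le_sub PC) (ac_le_sub QC) AB.
Qed.

Lemma mdl_uniq A P Q : mdl A P -> mdl A Q -> P = Q.
Proof. by move=> mP mQ; apply: (ac_le_anti (mdl_le mP mQ _) (mdl_le mQ mP _)). Qed.

Lemma mdlP P : ac_le K P C -> Klam P -> mdl (dom P) P.
Proof. by []. Qed.

Lemma sm_C A : sm A -> A `<=` dom C.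
Proof. by move=> [P [/ac_le_sub[s _ _] _ <-]]. Qed.

Lemma sm_card A : sm A -> A #<= [set: lam].
Proof. by move=> [P [_ /Klam_le c <-]]. Qed.

Lemma ks_sm A : ks A -> sm A.
Proof. by move=> [P [mP _]]; exists P. Qed.

Lemma mdl_K' A P : ks A -> mdl A P -> K' P.
Proof. by move=> [Q [mQ KQ]] mP; rewrite (mdl_uniq mP mQ). Qed.

Lemma emb_sm f A : emb f A -> sm A.
Proof. by move=> [P [mP _]]; exists P. Qed.

Lemma emb_mdl f A P : emb f A -> mdl A P -> embedding K f P C.
Proof. by move=> [Q [mQ eQ]] mP; rewrite (mdl_uniq mP mQ). Qed.

Lemma emb_iso f A P : emb f A -> mdl A P ->
  exists P', iso f P P' /\ mdl (f @` A) P'.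
Proof.
move=> ef mP; have [P' iP P'C] := emb_mdl ef mP; exists P'; split=> //.
have [_ KP <-] := mP; split=> //; first exact: Klam_iso iP KP.
exact: iso_dom iP.
Qed.

Lemma iso_emb f A P P' : mdl A P -> iso f P P' -> ac_le K P' C -> emb f A.
Proof. by move=> mP iP le; exists P; split=> //; exists P'. Qed.

Lemma emb_img f A : emb f A -> sm (f @` A).
Proof. by move=> ef; have [P mP] := emb_sm ef; have [P' [_ ?]] := emb_iso ef mP; exists P'. Qed.

Lemma emb_inj f A x y : emb f A -> A x -> A y -> f x = f y -> x = y.
Proof. by move=> [P [[_ _ <-] eP]]; exact: embedding_inj eP. Qed.

Lemma emb_C f A x : emb f A -> A x -> dom C (f x).
Proof. by move=> [P [[_ _ <-] eP]]; exact: embedding_dom eP. Qed.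

Lemma emb_eq f g A : (forall x, A x -> f x = g x) -> emb f A -> emb g A.
Proof.
by move=> e [P [[PC KP dP] eP]]; exists P; split=> //; apply: embedding_ext eP;
  rewrite dP.
Qed.

Lemma emb_id A : sm A -> emb id A.
Proof. by move=> [P mP]; exists P; split=> //; apply: embedding_id; case: mP. Qed.

Lemma emb_comp f g A : emb f A -> emb g (f @` A) -> emb (g \o f) A.
Proof.
move=> ef eg; have [P mP] := emb_sm ef; have [P' [iP mP']] := emb_iso ef mP.
have [P'' [iP' mP'']] := emb_iso eg mP'.
by apply: (iso_emb mP (iso_comp iP iP')); case: mP''.
Qed.

Lemma emb_inv f A : emb f A ->
  exists g, emb g (f @` A) /\ forall x, A x -> g (f x) = x.
Proof.
move=> ef; have [P mP] := emb_sm ef; have [P' [iP mP']] := emb_iso ef mP.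
have [g [iG gf _]] := iso_inv iP; have [PC _ dP] := mP.
by exists g; split; [exact: iso_emb mP' iG PC|rewrite -dP].
Qed.

Lemma emb_sub f A B : emb f A -> sm B -> B `<=` A -> emb f B.
Proof.
move=> [P [mP eP]] [Q mQ] BA; exists Q; split=> //; apply: embedding_sub eP _.
exact: mdl_le mQ mP BA.
Qed.

Lemma emb_ext f A B : emb f A -> sm B -> A `<=` B ->
  exists g, emb g B /\ forall x, A x -> g x = f x.
Proof.
move=> [P [mP eP]] [Q mQ] AB; have [_ KP dP] := mP; have [_ KQ _] := mQ.
have [g [eg gE]] := C_ext KP KQ (mdl_le mP mQ AB) eP.
by exists g; split; [exists Q|rewrite -dP].
Qed.

Lemma ks_emb f A : ks A -> emb f A -> ks (f @` A).
Proof.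
move=> [P [mP KP]] ef; have [P' [iP mP']] := emb_iso ef mP.
by exists P'; split=> //; exact: ac_mem_iso iP KP.
Qed.

Lemma univ_sm A B : univ A B -> sm A /\ sm B.
Proof. by move=> [P [Q [mP mQ _]]]; split; [exists P|exists Q]. Qed.

Lemma univ_incl A B : univ A B -> A `<=` B.
Proof. by move=> [P [Q [[_ _ <-] [_ _ <-] [_ _ /ac_le_sub[]]]]]. Qed.

Lemma univ_mdl A B P Q : univ A B -> mdl A P -> mdl B Q -> universal K lam P Q.
Proof.
by move=> [P' [Q' [mP' mQ' u]]] mP mQ; rewrite (mdl_uniq mP mP') (mdl_uniq mQ mQ').
Qed.

Lemma univ_subl A B D : sm A -> A `<=` B -> univ B D -> univ A D.
Proof.
move=> [P mP] AB [Q [R [mQ mR u]]]; exists P, R; split=> //.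
have [_ KP _] := mP.
exact: (universal_sub U_large lam_inf amalg KP (mdl_le mP mQ AB) u).
Qed.

Lemma univ_supr A B D : univ A B -> sm D -> B `<=` D -> univ A D.
Proof.
move=> [P [Q [mP mQ [KP KQ PQ u]]]] [R mR] BD; exists P, R; split=> //.
have [_ KR _] := mR; have QR := mdl_le mQ mR BD.
split=> //; first exact: ac_le_trans PQ QR.
move=> N KN PN; have [h [eh fh]] := u N KN PN; exists h; split=> //.
exact: embedding_le eh QR.
Qed.

Lemma univ_ext f A B D E : univ A B -> emb f D -> f @` D `<=` A -> sm E ->
  D `<=` E -> exists g, [/\ emb g E, forall x, D x -> g x = f x & g @` E `<=` B].
Proof.
move=> [P [Q [mP mQ u]]] ef fDA [R mR] DE; have [S mS] := emb_sm ef.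
have [S' [iS mS']] := emb_iso ef mS.
have [_ KS dS] := mS; have [_ KR dR] := mR.
have efS : embedding K f S P by exists S' => //; exact: mdl_le mS' mP fDA.
have [g [eg gE]] :=
  universal_ext U_large lam_inf amalg u KS KR (mdl_le mS mR DE) efS.
have [QC _ dQ] := mQ; exists g; split.
- by exists R; split=> //; exact: embedding_le eg QC.
- by rewrite -dS.
- by rewrite -dR -dQ => _ [x Rx <-]; exact: embedding_dom eg Rx.
Qed.

Lemma univ_emb f A B : univ A B -> emb f B -> univ (f @` A) (f @` B).
Proof.
move=> u efB; have [smA smB] := univ_sm u; have AB := univ_incl u.
have efA := emb_sub efB smA AB.
have [P mP] := smA; have [Q mQ] := smB.
have [P' [iP mP']] := emb_iso efA mP; have [Q' [iQ mQ']] := emb_iso efB mQ.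
exists P', Q'; split=> //; have [_ KP' _] := mP'; have [_ KQ' _] := mQ'.
have P'Q' : ac_le K P' Q'.
  by apply: (mdl_le mP' mQ') => _ [x Ax <-]; exists x => //; exact: AB.
split=> // N KN P'N; have [fi [iI fiE _]] := iso_inv iP.
have [_ _ dP] := mP; have [_ _ dQ] := mQ; have [_ _ dP'] := mP'.
have [|g [eg gE]] := @universal_ext _ _ K lam U_large lam_inf amalg fi P' N P Q
  (univ_mdl u mP mQ) KP' KN P'N.
  by exists P => //; apply: ac_le_refl; case: mP => _ [].
exists (f \o g); split.
  by apply: embedding_comp eg (embedding_iso iQ _); case: KQ'.
move=> y; rewrite dP' => -[x Ax <-] /=; rewrite gE ?fiE ?dP ?dP' //; by exists x.
Qed.

Lemma cover A : A `<=` dom C -> A #<= [set: lam] ->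
  exists Q : set U, [/\ ks Q, A `<=` Q & forall B, sm B -> B `<=` A -> univ B Q].
Proof.
move=> AC Al; have [Q [K'Q QC AQ uQ]] := C_cover AC Al.
have mQ : mdl (dom Q) Q by apply: mdlP => //; exact: K'lam.
exists (dom Q); split=> //; first by exists Q.
by move=> B [P [PC KP <-]] BA; exists P, Q; split=> //; exact: uQ.
Qed.

Lemma card_le1 (a : U) : [set a] #<= [set: lam].
Proof.
have [l _] := lam_inh lam_inf.
by apply: (@card_le_inj _ _ _ _ (fun=> l)) => // x y /set_mem-> /set_mem->.
Qed.

Lemma cover1 A a : sm A -> dom C a -> exists Q : set U, [/\ ks Q, A `<=` Q, Q a & univ A Q].
Proof.
move=> smA Ca; have [||Q [kQ AQ uQ]] := @cover (A `|` [set a]).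
- by move=> x [/(sm_C smA)|->].
- by apply: card_leU => //; [exact: sm_card|exact: card_le1].
exists Q; split=> //; first by move=> x Ax; apply: AQ; left.
  by apply: AQ; right.
by apply: uQ => // x Ax; left.
Qed.

Section Chain.
Context (I : woset) (F : I -> set U) (I_inh : exists i : I, True)
  (I_lam : [set: I] #<= [set: lam])
  (F_mono : forall i j, wo_lt i j -> F i `<=` F j).

Lemma mdl_chain (Ms : I -> structure L U) : (forall i, mdl (F i) (Ms i)) ->
  exists N, is_union Ms N /\ mdl (\bigcup_i F i) N.
Proof.
move=> mMs; have [|i|N [uN KN _ NP]] := chain_union_lam aecK lam_inf I_inh I_lam (Ms := Ms).
- by move=> i j /F_mono; exact: mdl_le.
- by have [] := mMs i.
exists N; split=> //; split=> //; first by apply: NP => i; have [] := mMs i.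
by have [-> _ _] := uN; apply: eq_bigcupr => i _; have [] := mMs i.
Qed.

Lemma sm_chain : (forall i, sm (F i)) -> sm (\bigcup_i F i).
Proof. by move=> /choice[Ms /mdl_chain[N [_ mN]]]; exists N. Qed.

Lemma emb_chain f : (forall i, emb f (F i)) -> emb f (\bigcup_i F i).
Proof.
move=> ef; have /choice[Ms mMs] : forall i, exists P, mdl (F i) P.
  by move=> i; exact: emb_sm (ef i).
have /choice[Ms' mMs'] : forall i, exists P', iso f (Ms i) P' /\ mdl (f @` F i) P'.
  by move=> i; exact: emb_iso.
have [N [[dN Nf Nr] mN]] := mdl_chain mMs.
have [|i|N' [uN' KN' _ N'P]] := chain_union_lam aecK lam_inf I_inh I_lam (Ms := Ms').
- move=> i j /F_mono ij; apply: mdl_le (proj2 (mMs' i)) (proj2 (mMs' j)) _.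
  exact: image_subset.
- by have [_ []] := mMs' i.
have N'C : ac_le K N' C by apply: N'P => i; have [_ []] := mMs' i.
have [dN' N'f N'r] := uN'.
apply: (iso_emb mN _ N'C).
have dMs i : dom (Ms i) = F i by have [] := mMs i.
have dMs' i : dom (Ms' i) = f @` F i by have [_ []] := mMs' i.
have isoi i : iso f (Ms i) (Ms' i) by have [] := mMs' i.
have fI x y : dom N x -> dom N y -> f x = f y -> x = y.
  have [_ _ ->] := mN => -[i _ Fx] [j _ Fy].
  have [/wo_le_eqVlt ij|/F_mono ji] := wo_leVlt i j; last first.
    by apply: (emb_inj (ef i)) => //; exact: ji.
  apply: (emb_inj (ef j)) => //; case: ij => [<-//|/F_mono]; exact.
split.
- split=> [x|x y /set_mem Nx /set_mem Ny|y].
  + rewrite dN dN' => -[i _ Nx]; exists i => //; exact: iso_fun (isoi i) Nx.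
  + exact: fI.
  + rewrite dN' => -[i _]; rewrite dMs' => -[x Fx <-]; exists x => //.
    by rewrite dN; exists i; rewrite ?dMs.
- move=> s x y Nx Ny; rewrite Nf N'f; split=> -[i].
    move=> xy; exists i; have [Mx My] := fn_dom xy.
    by have [_ isf _] := isoi i; apply/isf.
  move=> xy; exists i; have [Mx My] := fn_dom xy.
  have lft z : dom N z -> dom (Ms' i) (f z) -> dom (Ms i) z.
    move=> Nz; rewrite dMs' dMs => -[w Fw /fI <- //].
    by rewrite dN; exists i; rewrite ?dMs.
  have [_ isf _] := isoi i; apply/isf => //; last exact: lft Ny My.
  by move=> k; apply: lft (Mx k).
- move=> r x Nx; rewrite Nr N'r; split=> -[i].
    move=> rx; exists i; have Mx := rl_dom rx.
    by have [_ _ isr] := isoi i; apply/isr.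
  move=> rx; exists i; have Mx := rl_dom rx.
  have lft z : dom N z -> dom (Ms' i) (f z) -> dom (Ms i) z.
    move=> Nz; rewrite dMs' dMs => -[w Fw /fI <- //].
    by rewrite dN; exists i; rewrite ?dMs.
  have [_ _ isr] := isoi i; apply/isr => // k; exact: lft (Mx k).
Qed.

Lemma univ_chain_top i : limit_ordinal I -> (forall i j, wo_lt i j -> univ (F i) (F j)) ->
  univ (F i) (\bigcup_i F i).
Proof.
move=> lim u; have [j [ij _]] := wo_cof_limit i lim.
apply: (univ_supr (u _ _ ij)); last exact: bigcup_sup.
by apply: sm_chain => k; have [l [kl _]] := wo_cof_limit k lim; have [] := univ_sm (u _ _ kl).
Qed.

(** The union is a limit model over the first member, so the cofinality bound puts it in [K']. *)
Lemma ks_chain : limit_ordinal I -> cf_ge I kappa ->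
  (forall i j, wo_lt i j -> univ (F i) (F j)) -> ks (\bigcup_i F i).
Proof.
move=> lim cf u.
have /choice[Ms mMs] : forall i, sm (F i).
  by move=> k; have [l [kl _]] := wo_cof_limit k lim; have [] := univ_sm (u _ _ kl).
have [N [uN mN]] := mdl_chain mMs; exists N; split=> //; apply: K'limit.
have [i0 i0P] := wo_least I_inh.
exists I, (Ms i0); split=> //; split=> //; exists Ms; split; last first.
  by move=> i im; congr Ms; exact: wo_anti.
split=> // [i j ij|i]; first exact: univ_mdl (u _ _ ij) (mMs i) (mMs j).
exact: univ_mdl (univ_chain_top i lim u) (mMs i) mN.
Qed.

End Chain.

(** * Galois types in the monster model *)

Lemma eqtp_C A a b : eqtp A a b -> dom C a /\ dom C b.
Proof.
move=> [B [g [_ eg AB Ba [_ <-]]]]; split; first exact: sm_C (emb_sm eg) _ Ba.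
exact: emb_C eg Ba.
Qed.

Lemma eqtp_refl A a : sm A -> dom C a -> eqtp A a a.
Proof.
move=> smA Ca; have [Q [/ks_sm sQ AQ Qa _]] := cover1 smA Ca.
by exists Q, id; split=> //; exact: emb_id.
Qed.

(** The domain of the embedding witnessing [eqtp] can be prescribed: extend the given one to a model
    covering both domains and restrict. *)
Lemma eqtp_emb A B a b : eqtp A a b -> sm B -> A `<=` B -> B a ->
  exists g, [/\ emb g B, forall x, A x -> g x = x & g a = b].
Proof.
move=> [B' [g [smA eg AB' B'a [fg ga]]]] smB AB Ba.
have [||Q [/ks_sm smQ BQ _]] := @cover (B `|` B').
- by move=> x [/(sm_C smB)|/(sm_C (emb_sm eg))].
- by apply: card_leU => //; apply: sm_card => //; exact: emb_sm eg.
have [h [eh hE]] := emb_ext eg smQ (fun x Bx => BQ x (or_intror Bx)).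
exists h; split; first by apply: emb_sub eh smB _ => x Bx; apply: BQ; left.
  by move=> x Ax; rewrite hE ?fg //; exact: AB'.
by rewrite hE.
Qed.

Lemma eqtp_trans A b a c : eqtp A a b -> eqtp A b c -> eqtp A a c.
Proof.
move=> [B [g [smA eg AB Ba [fg ga]]]] bc.
have [||h [eh fh hb]] := eqtp_emb bc (emb_img eg).
- by move=> x Ax; exists x; [exact: AB|exact: fg].
- by exists a.
exists B, (h \o g); split=> //; first exact: emb_comp.
by split=> [x Ax|] /=; [rewrite fg ?fh|rewrite ga].
Qed.

Lemma eqtp_sym A a b : eqtp A a b -> eqtp A b a.
Proof.
move=> [B [g [smA eg AB Ba [fg ga]]]]; have [h [eh hg]] := emb_inv eg.
exists (g @` B), h; split=> //; last 1 first.
- by split=> [x Ax|]; [rewrite -{1}(fg x Ax) hg //; exact: AB|rewrite -ga hg].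
- by move=> x Ax; exists x; [exact: AB|exact: fg].
- by exists a.
Qed.

Lemma eqtp_sub A B a b : sm A -> A `<=` B -> eqtp B a b -> eqtp A a b.
Proof.
move=> smA AB [D [g [smB eg BD Da [fg ga]]]]; exists D, g; split=> //.
  exact: subset_trans BD.
by split=> // x /AB/fg.
Qed.

(** For extending an embedding of [A] with a prescribed value at [a]: first move [a] to [r] over
    [A], then apply an extension of [f']. *)
Lemma emb_realize f f' A B E a r : eqtp A a r -> sm B -> A `<=` B -> B a ->
  emb f' E -> A `<=` E -> E r -> (forall x, A x -> f' x = f x) ->
  exists g, [/\ emb g B, forall x, A x -> g x = f x & g a = f' r].
Proof.
move=> ar smB AB Ba ef' AE Er f'E; have [g [eg fg ga]] := eqtp_emb ar smB AB Ba.
have [||Q [/ks_sm smQ EQ _]] := @cover (E `|` g @` B).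
- by move=> x [/(sm_C (emb_sm ef'))|/(sm_C (emb_img eg))].
- by apply: card_leU => //; apply: sm_card; [exact: emb_sm ef'|exact: emb_img].
have [k [ek kE]] := emb_ext ef' smQ (fun x Ex => EQ x (or_introl Ex)).
have ekg : emb k (g @` B).
  by apply: emb_sub ek (emb_img eg) _ => x gx; apply: EQ; right.
exists (k \o g); split; first exact: emb_comp.
  by move=> x Ax /=; rewrite fg // kE ?f'E //; exact: AE.
by rewrite /= ga kE.
Qed.

Lemma univ_realize A B r : univ A B -> dom C r -> exists2 a, B a & eqtp A a r.
Proof.
move=> u Cr; have [smA smB] := univ_sm u.
have [Q [/ks_sm smQ AQ Qr _]] := cover1 smA Cr.
have [|g [eg gE gB]] := univ_ext u (emb_id smA) _ smQ AQ.
  by move=> _ [x Ax <-].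
exists (g r); first by apply: gB; exists r.
apply: eqtp_sym; exists Q, g; split=> //; split=> // x; exact: gE.
Qed.

Lemma gtp_refl P a R : pretype K lam P (a, R) -> gtp_equiv K lam P (a, R) (a, R).
Proof.
move=> pP; have [KP KR PR Ra] := pP; apply: t_step; split=> //.
exists R, id, id; have eR : embedding K id R R.
  by apply: embedding_id; apply: ac_le_refl; case: KR.
by split.
Qed.

Lemma gtp_sym P x y : gtp_equiv K lam P x y -> gtp_equiv K lam P y x.
Proof.
elim=> [{}x {}y [px py [N [f [g [KN ef eg e]]]]]|{}x {}y z _ yx _ zy].
  by apply: t_step; split=> //; exists N, g, f.
exact: t_trans zy yx.
Qed.

Lemma gtp_equiv_eq P a R b R' : pretype K lam P (b, R') ->
  gtp K lam a P R = gtp K lam b P R' <-> gtp_equiv K lam P (a, R) (b, R').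
Proof.
move=> pb; split=> [e|ab].
  have : gtp K lam b P R' (b, R') by exact: gtp_refl.
  by rewrite -e.
apply/seteqP; split=> y /= h; last exact: t_trans ab h.
by apply: t_trans h; exact: gtp_sym.
Qed.

Lemma gtp_embedding A P a N f : mdl A P -> pretype K lam P (a, N) ->
  embedding K f N C -> fixes f P -> exists R, [/\ iso f N R, ac_le K R C,
    pretype K lam P (f a, R) & gtp K lam a P N = gtp K lam (f a) P R].
Proof.
move=> mP pa [R iR RC] fP; have [KP KN PN Na] := pa.
have KR := Klam_iso iR KN; have mR : mdl (dom R) R by exact: mdlP.
have PR : ac_le K P R.
  apply: (mdl_le mP mR) => x; have [_ _ <-] := mP => Px.
  rewrite -(fP _ Px); apply: (iso_fun iR).
  by have [s _ _] := ac_le_sub PN; exact: s.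
have pR : pretype K lam P (f a, R) by split=> //; exact: iso_fun iR Na.
exists R; split=> //; apply/gtp_equiv_eq => //; apply: t_step; split=> //.
exists R, f, id; split=> //; last first.
  by split=> //; apply: embedding_id; apply: ac_le_refl; case: KR.
by split=> //; apply: embedding_iso => //; case: KR.
Qed.

Lemma fixes_id A P f : mdl A P -> (forall x, A x -> f x = x) <-> fixes f P.
Proof. by move=> [_ _ <-]. Qed.

Lemma gtp_eqtp A P a R b R' : mdl A P -> pretype K lam P (a, R) ->
  pretype K lam P (b, R') -> ac_le K R C -> ac_le K R' C ->
  gtp K lam a P R = gtp K lam b P R' <-> eqtp A a b.
Proof.
move=> mP pa pb RC R'C; have [KP KR PR Ra] := pa; have [_ KR' PR' R'b] := pb.
have [smR smR'] : sm (dom R) /\ sm (dom R') by split; [exists R|exists R'].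
have dP : dom P = A by case: mP.
have AR : A `<=` dom R by rewrite -dP; have [] := ac_le_sub PR.
have AR' : A `<=` dom R' by rewrite -dP; have [] := ac_le_sub PR'.
split; last first.
  move=> ab; have [g [eg fg ga]] := eqtp_emb ab smR AR Ra.
  have eg' : embedding K g R C by apply: emb_mdl eg _; exact: mdlP.
  have fP := proj1 (fixes_id g mP) fg.
  have [R2 [iR R2C pga e]] := gtp_embedding mP pa eg' fP.
  rewrite e ga in pga *; apply/gtp_equiv_eq => //; apply: t_step; split=> //.
  have [_ KR2 _ _] := pga.
  have [||Q [[Q' [mQ K'Q]] RQ _]] := @cover (dom R2 `|` dom R').
  - by move=> x [|]; [have [s _ _] := ac_le_sub R2C|have [s _ _] := ac_le_sub R'C]; exact: s.
  - by apply: card_leU => //; [exact: Klam_le KR2|exact: Klam_le KR'].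
  exists Q', id, id; split; first exact: K'lam.
  - split=> //; apply: embedding_id; apply: mdl_le (mdlP R2C KR2) mQ _.
    by move=> x Rx; apply: RQ; left.
  - split=> //; apply: embedding_id; apply: mdl_le (mdlP R'C KR') mQ _.
    by move=> x Rx; apply: RQ; right.
  - by [].
move=> /(gtp_equiv_eq _ _ pb) ab.
(* Invariant along the chain of atomic equivalences: the ambient model of the pair embeds into [C]
   over [P] with its distinguished point sent to [a]. Homogeneity of [C] carries it across one
   amalgam. *)
pose good (x : U * structure L U) := pretype K lam P x ->
  exists g, [/\ embedding K g x.2 C, fixes g P & g x.1 = a].
have step x y : gtp_equiv K lam P x y -> good x -> good y.
  elim=> {x y} [x y [px py [N [f [f' [KN [ef ff] [ef' ff'] e]]]]] gx _|].
    have [_ Kx Px x1] := px; have [g [eg fg ga]] := gx px.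
    have [x' ix x'N] := ef; have [fi [ii fiE _]] := iso_inv ix.
    have Kx' := Klam_iso ix Kx.
    have egf : embedding K (g \o fi) x' C.
      by apply: embedding_comp eg; exact: embedding_iso ii (proj1 Kx).
    have [k [ek kE]] := C_ext Kx' KN x'N egf.
    have kf z : dom x.2 z -> k (f z) = g z.
      by move=> xz; rewrite kE /= ?fiE //; exact: iso_fun ix xz.
    have Pxs z : dom P z -> dom x.2 z by have [s _ _] := ac_le_sub Px; exact: s.
    exists (k \o f'); split; first exact: embedding_comp ek.
      by move=> z Pz /=; rewrite ff' // -{1}(ff _ Pz) kf ?fg //; exact: Pxs.
    by rewrite /= -e kf.
  by move=> x y z _ xy _ yz gx; apply: yz; exact: xy.
have [|//|g [eg fg gb]] := step _ _ ab.
  by move=> _; exists id; split=> //; exact: embedding_id.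
apply: eqtp_sym; exists (dom R'), g; split=> //; first by exists P.
  by exists R'; split=> //; exact: mdlP.
by split=> //; exact: (proj2 (fixes_id g mP)).
Qed.

Lemma env A a P : mdl A P -> dom C a ->
  exists R, [/\ ac_le K R C, K' R & pretype K lam P (a, R)].
Proof.
move=> mP Ca; have [|Q [[R [mR KR]] AQ Qa _]] := @cover1 A a _ Ca; first by exists P.
have [RC KlR dR] := mR; have [_ KP _] := mP.
by exists R; split=> //; split=> //; [exact: mdl_le mP mR AQ|rewrite /= dR].
Qed.

Lemma gS_C A P p : mdl A P -> gS K lam P p -> exists a R,
  [/\ dom C a, ac_le K R C, pretype K lam P (a, R) & p = gtp K lam a P R].
Proof.
move=> mP [b [N [pb ->]]]; have [KP KN PN _] := pb.
have [f [ef fE]] := C_ext KP KN PN (embedding_id (let: And3 PC _ _ := mP in PC)).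
have [R [iR RC pR e]] := gtp_embedding mP pb ef fE.
exists (f b), R; split=> //; have [_ _ _ Rb] := pR.
by have [s _ _] := ac_le_sub RC; exact: s.
Qed.

(** The representative that witnesses nonforking may live outside [C]. It is moved into [C] over
    [Q], then onto [a] over [Q], and invariance under isomorphism applies to the composite. *)
Lemma nonforking_NF A B P Q a R : mdl A P -> mdl B Q -> pretype K lam Q (a, R) ->
  ac_le K R C -> nonforking K lam ind P Q (gtp K lam a Q R) <-> NF A a B.
Proof.
move=> mP mQ pa RC; split; last first.
  move=> [P' [Q' [R' [mP' mQ' R'C]]]]; rewrite (mdl_uniq mP' mP) (mdl_uniq mQ' mQ) => i.
  have [_ /ac_le_mem[K'Q K'R'] R'a] := ind_dom indP i.
  exists a, R'; split=> //.
  have [_ QR' _] := ind_dom indP i.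
  have pa' : pretype K lam Q (a, R').
    have [KQ _ _ _] := pa; split=> //; first exact: K'lam.
    by have [_ s] := subK; apply/s.
  apply/(gtp_eqtp mQ pa pa' RC R'C); apply: eqtp_refl; first by exists Q.
  by have [s _ _] := ac_le_sub R'C; exact: s.
move=> [b [N [i e]]]; have [PQ' QN' Nb] := ind_dom indP i.
have [K'Q K'N] := ac_le_mem QN'.
have QN : ac_le K Q N by have [_ s] := subK; apply/s.
have KQ := K'lam K'Q; have KN := K'lam K'N.
have pb : pretype K lam Q (b, N) by [].
have [f [ef fE]] := C_ext KQ KN QN (embedding_id (let: And3 QC _ _ := mQ in QC)).
have [R2 [iR R2C pR e2]] := gtp_embedding mQ pb ef fE.
rewrite e2 in e; have /(gtp_eqtp mQ pa pR RC R2C)/eqtp_sym ba := e.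
have [_ KR2 QR2 R2b] := pR; have dQ : dom Q = B by case: mQ.
have [||//|g [eg fg ga]] := eqtp_emb ba (B := dom R2); first by exists R2.
  by rewrite -dQ; have [] := ac_le_sub QR2.
have [R3 [iR3 mR3]] := emb_iso eg (mdlP R2C KR2).
have gQ x : dom Q x -> id x = (g \o f) x.
  by move=> Qx /=; rewrite fE // fg // -dQ.
have gP x : dom P x -> id x = (g \o f) x.
  by move=> Px; apply: gQ; have [s _ _] := ac_le_sub PQ'; exact: s.
have := ind_iso indP i (iso_comp iR iR3) (iso_ext gQ (iso_id Q)) (iso_ext gP (iso_id P)).
by rewrite /= ga => i3; exists P, Q, R3; split=> //; case: mR3.
Qed.

Lemma NF_dom A a B : NF A a B -> [/\ ks A, ks B, A `<=` B & dom C a].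
Proof.
move=> [P [Q [R [mP mQ RC i]]]]; have [PQ QR Ra] := ind_dom indP i.
have [KP KQ] := ac_le_mem PQ; split; [by exists P|by exists Q| |].
  by have [_ _ <-] := mP; have [_ _ <-] := mQ; have [] := ac_le_sub PQ.
by have [s _ _] := ac_le_sub RC; exact: s.
Qed.

Lemma ks_le A B P Q : ks A -> ks B -> mdl A P -> mdl B Q -> A `<=` B -> ac_le K' P Q.
Proof.
move=> kA kB mP mQ AB; have [_ s] := subK; apply/s.
- exact: mdl_K' mP.
- exact: mdl_K' mQ.
- exact: mdl_le AB.
Qed.

Lemma NF_base A D a B : NF A a B -> ks D -> A `<=` D -> D `<=` B -> NF D a B.
Proof.
move=> nf kD AD DB; have [kA kB AB _] := NF_dom nf.
have [P [Q [R [mP mQ RC i]]]] := nf; have [S mS] := ks_sm kD.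
exists S, Q, R; split=> //; apply: (ind_base_mono indP i).
  exact: ks_le mP mS AD.
exact: ks_le mS mQ DB.
Qed.

Lemma NF_mono A D a B : NF A a B -> ks D -> A `<=` D -> D `<=` B -> NF A a D.
Proof.
move=> nf kD AD DB; have [kA kB AB _] := NF_dom nf.
have [P [Q [R [mP mQ RC i]]]] := nf; have [S mS] := ks_sm kD.
have [_ QR Ra] := ind_dom indP i; have [_ KR] := ac_le_mem QR.
have [] := ind_mono indP i (ks_le kA kD mP mS AD) (ks_le kD kB mS mQ DB) QR
  (ac_le_refl KR) (ac_le_refl KR) Ra.
by move=> i' _; exists P, S, R.
Qed.

Lemma NF_emb f A a B E : NF A a B -> emb f E -> B `<=` E -> E a ->
  NF (f @` A) (f a) (f @` B).
Proof.
move=> nf ef BE Ea; have [kA kB AB Ca] := NF_dom nf.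
have [P [Q [R [mP mQ RC i]]]] := nf; have [PQ QR Ra] := ind_dom indP i.
have [_ K'R] := ac_le_mem QR; have KR := K'lam K'R.
have smR : sm (dom R) by exists R.
have [||T [/ks_sm smT ET _]] := @cover (E `|` dom R).
- by move=> x [/(sm_C (emb_sm ef))|/(sm_C smR)].
- by apply: card_leU => //; apply: sm_card => //; exact: emb_sm ef.
have [g [eg gE]] := emb_ext ef smT (fun x Ex => ET x (or_introl Ex)).
have egR : emb g (dom R) by apply: emb_sub eg smR _ => x Rx; apply: ET; right.
have efB := emb_sub ef (ks_sm kB) BE.
have efA := emb_sub ef (ks_sm kA) (subset_trans AB BE).
have [R' [iR mR']] := emb_iso egR (mdlP RC KR).
have [P' [iP mP']] := emb_iso efA mP; have [Q' [iQ mQ']] := emb_iso efB mQ.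
have gQ x : dom Q x -> f x = g x.
  by have [_ _ ->] := mQ => Bx; rewrite gE //; exact: BE.
have gP x : dom P x -> f x = g x.
  by move=> Px; apply: gQ; have [s _ _] := ac_le_sub PQ; exact: s.
have := ind_iso indP i iR (iso_ext gQ iQ) (iso_ext gP iP).
by rewrite gE // => i'; exists P', Q', R'; split=> //; case: mR'.
Qed.

Lemma NF_eqtp A a b B : NF A a B -> eqtp B a b -> NF A b B.
Proof.
move=> nf ab; have [kA kB AB Ca] := NF_dom nf.
have [E [g [_ eg BE Ea [fg <-]]]] := ab.
have := NF_emb nf eg BE Ea.
have img D : D `<=` B -> g @` D = D.
  move=> DB; apply/seteqP; split=> x; first by case=> y Dy <-; rewrite fg //; exact: DB.
  by move=> Dx; exists x; rewrite ?fg //; exact: DB.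
by rewrite !img.
Qed.

(** * The properties of independence, restated for points and submodels of [C] *)

Lemma restr_env A B P Q a R : mdl A P -> mdl B Q -> A `<=` B ->
  pretype K lam Q (a, R) -> ac_le K R C ->
  restr K lam P (gtp K lam a Q R) = gtp K lam a P R /\ pretype K lam P (a, R).
Proof.
move=> mP mQ AB pa RC; have [_ KP _] := mP; have PQ := mdl_le mP mQ AB.
split; first exact: restr_gtp.
by have [_ KR QR Ra] := pa; split=> //; exact: ac_le_trans PQ QR.
Qed.

Lemma NF_uniq A B D a b : univ A B -> ks B -> B `<=` D -> NF A a D -> NF A b D ->
  eqtp B a b -> eqtp D a b.
Proof.
move=> u kB BD nfa nfb ab; have [kA kD AD Ca] := NF_dom nfa.
have [_ _ _ Cb] := NF_dom nfb.
have [P mP] := ks_sm kA; have [Q mQ] := ks_sm kB; have [S mS] := ks_sm kD.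
have [R [RC KR pa]] := env mS Ca; have [R' [R'C KR' pb]] := env mS Cb.
apply/(gtp_eqtp mS pa pb RC R'C).
have [ra pa'] := restr_env mQ mS BD pa RC; have [rb pb'] := restr_env mQ mS BD pb R'C.
apply: (wuniq (mdl_K' kA mP) (univ_mdl u mP mQ) (ks_le kB kD mQ mS BD)).
- by exists a, R.
- by exists b, R'.
- exact/(nonforking_NF mP mS).
- exact/(nonforking_NF mP mS).
- by rewrite ra rb; apply/(gtp_eqtp mQ).
Qed.

Lemma NF_ext A B D a : univ A B -> NF A a B -> ks D -> B `<=` D ->
  exists b, NF A b D /\ eqtp B b a.
Proof.
move=> u nfa kD BD; have [kA kB AB Ca] := NF_dom nfa.
have [P mP] := ks_sm kA; have [Q mQ] := ks_sm kB; have [S mS] := ks_sm kD.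
have [R [RC KR pa]] := env mQ Ca.
have [||q [gq nfq rq]] := wext (mdl_K' kA mP) (univ_mdl u mP mQ)
  (ks_le kB kD mQ mS BD) (p := gtp K lam a Q R).
- by exists a, R.
- exact/(nonforking_NF mP mQ).
have [b [R' [Cb R'C pb eq]]] := gS_C mS gq.
have [rb pb'] := restr_env mQ mS BD pb R'C.
exists b; split; first by apply/(nonforking_NF mP mS pb R'C); rewrite -eq.
by apply/(gtp_eqtp mQ pb' pa R'C RC); rewrite -rb -eq.
Qed.

Lemma NF_loc (I : woset) (F : I -> set U) r : limit_ordinal I ->
  [set: I] #<= [set: lam] -> cf_ge I kappa -> (forall i, ks (F i)) ->
  (forall i j, wo_lt i j -> univ (F i) (F j)) -> dom C r ->
  exists i, NF (F i) r (\bigcup_i F i).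
Proof.
move=> lim Il cf kF u Cr; have Ii : exists i : I, True by case: lim.
have mono i j (ij : wo_lt i j) := univ_incl (u i j ij).
have /choice[Ms mMs] : forall i, sm (F i) by move=> i; exact: ks_sm.
have [N [uN mN]] := mdl_chain Ii Il mono mMs.
have kN := ks_chain Ii Il mono lim cf u.
have [R [RC KR pr]] := env mN Cr.
have [||||i nf] := locchar lim cf (Ms := Ms) (N := N) (p := gtp K lam r N R).
- by move=> i; exact: mdl_K' (mMs i).
- exact: mdl_K' mN.
- split=> // [i j ij|i]; first exact: univ_mdl (u _ _ ij) (mMs i) (mMs j).
  exact: univ_mdl (univ_chain_top Ii Il mono i lim u) (mMs i) mN.
- by exists r, R.
by exists i; apply/(nonforking_NF (mMs i) mN pr RC).
Qed.

(** The types of [a] and of [b] over the union both extend the types of [a] over the [F i], so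
    uniqueness in universal continuity* identifies them. The cofinality of [I] is arbitrary and the
    union may lie outside [K']; the model of [K'] above the chain is [R]. *)
Lemma NF_cont (I : woset) (F : I -> set U) a b : limit_ordinal I ->
  [set: I] #<= [set: lam] -> (forall i j, wo_lt i j -> univ (F i) (F j)) ->
  (forall i, NF (F i) a (F i)) -> (forall i, eqtp (F i) a b) ->
  eqtp (\bigcup_i F i) a b.
Proof.
move=> lim Il u nfa ab; have Ii : exists i : I, True by case: lim.
have mono i j (ij : wo_lt i j) := univ_incl (u i j ij).
have kF i : ks (F i) by have [] := NF_dom (nfa i).
have /choice[Ms mMs] : forall i, sm (F i) by move=> i; exact: ks_sm.
have [N [uN mN]] := mdl_chain Ii Il mono mMs.
have [i0 _] := Ii; have [Ca Cb] := eqtp_C (ab i0).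
have [R [RC KR pa]] := env mN Ca; have [R' [R'C KR' pb]] := env mN Cb.
have FN i : F i `<=` \bigcup_i F i by exact: bigcup_sup.
have ra i := proj1 (restr_env (mMs i) mN (FN i) pa RC).
have pai i := proj2 (restr_env (mMs i) mN (FN i) pa RC).
have rb i := proj1 (restr_env (mMs i) mN (FN i) pb R'C).
have pbi i := proj2 (restr_env (mMs i) mN (FN i) pb R'C).
have [_ KN _] := mN.
have [|||||||||p [_ pU]] := @ucont I Ms N R (fun i => gtp K lam a (Ms i) R) lim.
- by move=> i; exact: mdl_K' (mMs i).
- by move=> i j ij; exact: univ_mdl (u _ _ ij) (mMs i) (mMs j).
- exact: uN.
- exact: KN.
- exact: KR.
- by move=> i; have [] := pai i.
- by move=> i; exists a, R.
- move=> i j ij.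
  exact: (proj1 (restr_env (mMs i) (mMs j) (mono i j ij) (pai j) RC)).
- by move=> i; apply/(nonforking_NF (mMs i) (mMs i) (pai i) RC).
apply/(gtp_eqtp mN pa pb RC R'C); rewrite -(pU (gtp K lam a N R)).
  apply: pU; split; first by exists b, R'.
  move=> i; rewrite rb; apply/(gtp_eqtp (mMs i) (pbi i) (pai i) R'C RC).
  exact: eqtp_sym.
by split=> //; exists a, R.
Qed.

(** Stability codes the types over [A] by elements of [lam]; [E l] realizes the type with code [l],
    and is arbitrary if no type has this code. *)
Lemma type_enum A : sm A ->
  exists E : lam -> U, forall r, dom C r -> exists l, eqtp A (E l) r.
Proof.
move=> [P mP]; have [_ KP _] := mP; have [l0 _] := lam_inh lam_inf.
have /(card_le_set l0)[code codeI] := stable KP.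
have /choice[R RP] : forall r, exists R, dom C r ->
    [/\ ac_le K R C, K' R & pretype K lam P (r, R)].
  move=> r; have [/(env mP)[R ?]|n] := pselect (dom C r); first by exists R.
  by exists P.
have [u0 _] : exists u : U, True.
  have /card_leTP[f _] : [set: nat] #<= [set: dom P].
    by rewrite (card_le_eqr (card_setT _)); exact: card_le_trans (Klam_ge KP).
  by exists (set_val (f 0)).
have /choice[E EP] : forall l, exists e, forall r, dom C r ->
    code (gtp K lam r P (R r)) = l -> dom C e /\ code (gtp K lam e P (R e)) = l.
  move=> l; have [[r Cr rl]|n] :=
    pselect (exists2 r, dom C r & code (gtp K lam r P (R r)) = l); first by exists r.
  by exists u0 => r Cr rl; case: n; exists r.
exists E => r Cr; exists (code (gtp K lam r P (R r))).
have [Ce e] := EP _ _ Cr erefl.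
have [RC _ pr] := RP _ Cr; have [ReC _ pe] := RP _ Ce.
apply/(gtp_eqtp mP pe pr ReC RC); apply: codeI => //.
  by apply: mem_set; eexists; eexists; split; first exact: pe.
by apply: mem_set; exists r, (R r).
Qed.


Lemma seg_card (X : woset) (Q : X -> Prop) : [set: X] #<= [set: lam] ->
  [set: wo_sub Q] #<= [set: lam].
Proof.
apply: card_le_trans; apply/card_leTP; exists sval => -[x px] [y py] /= e.
exact: eq_exist.
Qed.

Lemma emb_glue (I : woset) (F : I -> set U) (f : I -> U -> U) :
  (exists i : I, True) -> [set: I] #<= [set: lam] ->
  (forall i j, wo_lt i j -> F i `<=` F j) -> (forall i, emb (f i) (F i)) ->
  (forall i j, wo_lt i j -> forall x, F i x -> f j x = f i x) ->
  exists g, emb g (\bigcup_i F i) /\ forall i x, F i x -> g x = f i x.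
Proof.
move=> Ii Il mono ef fE.
have fE' i j x : F i x -> F j x -> f i x = f j x.
  move=> Fi Fj; have [/wo_le_eqVlt[->//|ij]|ji] := wo_leVlt i j.
    by rewrite (fE i j).
  by rewrite (fE j i).
have [i0 _] := Ii.
have /choice[k kP] : forall x, exists i, (\bigcup_i F i) x -> F i x.
  move=> x; have [[i _ Fx]|n] := pselect ((\bigcup_i F i) x); first by exists i.
  by exists i0.
have gE i x : F i x -> f (k x) x = f i x.
  by move=> Fx; apply: fE' => //; apply: kP; exists i.
exists (fun x => f (k x) x); split=> //; apply: emb_chain => // i.
by apply: emb_eq (ef i) => x Fx; rewrite (gE i).
Qed.

(** The limit step of the recursions below. *)
Lemma emb_glue_seg (X : woset) (x : X) (F : X -> set U) (f : X -> U -> U) :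
  [set: X] #<= [set: lam] -> (exists y, wo_lt y x) ->
  (forall y z, wo_lt y z -> F y `<=` F z) ->
  (forall y, wo_lt y x -> emb (f y) (F y)) ->
  (forall y z, wo_lt y z -> wo_lt z x -> forall u, F y u -> f z u = f y u) ->
  exists D g, [/\ emb g D, forall y, wo_lt y x -> F y `<=` D,
    forall u, D u -> exists2 y, wo_lt y x & F y u
    & forall y u, wo_lt y x -> F y u -> g u = f y u].
Proof.
move=> Xl [y0 y0x] mono ef fE.
pose S := wo_sub (fun y => wo_lt y x).
have [||||s t st|g [eg gE]] :=
  @emb_glue S (fun s => F (sval s)) (fun s => f (sval s)).
- by exists (exist _ y0 y0x).
- exact: seg_card.
- by move=> s t /wo_sub_ltE; exact: mono.
- by move=> [y yx]; exact: ef.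
- by apply: fE; [apply/wo_sub_ltE|case: (t)].
exists (\bigcup_(s : S) F (sval s)), g; split=> //.
- by move=> y yx u Fu; exists (exist _ y yx).
- by move=> u [[y yx] _ Fu]; exists y.
- by move=> y u yx Fu; rewrite (gE (exist _ y yx)).
Qed.

(** Pulls [B] back along [f] to an extension of [A] itself, with [l] leading back to [B]. Types over
    the image of [f] thereby become types over [A]. *)
Lemma emb_inv_ext f A B : emb f A -> sm B -> f @` A `<=` B ->
  exists k, [/\ emb k B, forall x, A x -> k (f x) = x
    & exists l, [/\ emb l (k @` B), forall u, B u -> l (k u) = u
      & forall x, A x -> l x = f x]].
Proof.
move=> ef smB fAB; have [fi [efi fiE]] := emb_inv ef.
have [k [ek kE]] := emb_ext efi smB fAB.
have [l [el lE]] := emb_inv ek.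
have kf x : A x -> k (f x) = x.
  by move=> Ax; rewrite kE ?fiE //; exists x.
exists k; split=> //; exists l; split=> // x Ax; rewrite -{1}(kf x Ax) lE //.
by apply: fAB; exists x.
Qed.

(** * Back and forth *)

(** The construction runs backwards: instead of embedding [E] piece by piece, the chain is embedded
    into [C] over [F x0] so that its image swallows [E], and the inverse is restricted to [E].
    Realizing single types suffices, since stage [x] has one point [n x] of the enumeration to
    catch. *)
Lemma universal_of_types (X : woset) (F : X -> set U) x0 :
  limit_ordinal X -> [set: X] #<= [set: lam] -> [set: lam] #<= [set: X] ->
  (forall x y, wo_lt x y -> F x `<=` F y) -> (forall x, sm (F x)) ->
  (forall x y r, wo_lt x y -> dom C r -> exists2 a, F y a & eqtp (F x) a r) ->
  (forall x, wo_le x0 x) ->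
  forall E, sm E -> F x0 `<=` E -> exists g, [/\ emb g E,
    forall u, F x0 u -> g u = u & g @` E `<=` \bigcup_x F x].
Proof.
move=> lim Xl lX mono smF types x0P E smE F0E.
have F0 x : F x0 `<=` F x.
  by have /wo_le_eqVlt[->//|/mono] := x0P x.
have [n [nE nS]] : exists n : X -> U, (forall x, E (n x)) /\ forall e, E e -> exists x, n x = e.
  have /card_leTP[c cI] : [set: E] #<= [set: X].
    by rewrite (card_le_eql (card_setT _)); exact: card_le_trans (sm_card smE) lX.
  have [e0 Ee0] : exists e, E e.
    have [P [_ KP <-]] := smE.
    have /card_leTP[f _] : [set: nat] #<= [set: dom P].
      by rewrite (card_le_eqr (card_setT _)); exact: card_le_trans (Klam_ge KP).
    by exists (set_val (f 0)); exact: set_valP (f 0).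
  have /choice[n nP] : forall x, exists e, E e /\ forall e', c e' = x -> e = set_val e'.
    move=> x; have [[e' <-]|nx] := pselect (exists e', c e' = x).
      by exists (set_val e'); split=> [|e'' /cI->//]; exact: set_valP.
    by exists e0; split=> // e' ce'; case: nx; exists e'.
  exists n; split=> [x|e Ee]; first by case: (nP x).
  exists (c (SigSub (mem_set Ee))).
  by have [_ /(_ _ erefl)] := nP (c (SigSub (mem_set Ee))).
pose Pr (h : X -> U -> U) x := [/\ emb (h x) (F x),
  forall y, wo_lt y x -> forall u, F y u -> h x u = h y u,
  forall y, wo_lt y x -> (h x @` F x) (n y)
  & forall u, F x0 u -> h x u = u].
have [|h x H|h hP] := @wo_rec X _ id Pr.
- move=> h h' x e [p1 p2 p3 p4]; rewrite /Pr -(e x) ?wo_refl //; split=> // y yx u Fu.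
  by rewrite (p2 _ yx) // e //; exact: wo_ltW.
- suff [f [ef fE fn f0]] : exists f, [/\ emb f (F x),
      forall y, wo_lt y x -> forall u, F y u -> f u = h y u,
      forall y, wo_lt y x -> (f @` F x) (n y)
      & forall u, F x0 u -> f u = u].
    exists f; rewrite /Pr; case: asboolP => // _; split=> // y yx.
    by case: asboolP => [e|_]; [case: (wo_lt_neq yx)|exact: fE].
  have [xm|[y sy]|[ex lm]] := wo_cases x.
  + have nx y : ~ wo_lt y x by move=> /wo_ltP; apply; exact: xm.
    exists id; split; [exact: emb_id| | |by []]; by move=> y /nx.
  + have [yx ym] := sy; have [ef fE fn f0] := H y yx; set f := h y in ef fE fn f0.
    have [Q' [/ks_sm smQ' FQ' Q'n _]] := cover1 (emb_img ef) (sm_C smE (nE y)).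
    (* [k (n y)] is a point whose type over [F y] is realized by some [a] in [F x]; the new
       embedding sends [a] to [n y]. *)
    have [k [ek kf [l [el lk lf]]]] := emb_inv_ext ef smQ' FQ'.
    have [a Fa ar] := types y x (k (n y)) yx (emb_C ek Q'n).
    have [||g [eg gE ga]] := emb_realize ar (smF x) (mono _ _ yx) Fa el _ _ lf.
    * by move=> u Fu; exists (f u); [apply: FQ'; exists u|exact: kf].
    * by exists (n y).
    exists g; split=> // [z zx u Fu|z zx|u Fu].
    * have /wo_le_eqVlt[e|zy] := ym z zx; first by rewrite e in Fu *; exact: gE.
      by rewrite gE ?(fE z) //; exact: (mono _ _ zy _ Fu).
    * have /wo_le_eqVlt[->|zy] := ym z zx; first by exists a; rewrite // ga lk.
      have [u Fu <-] := fn z zy; exists u; [exact: (mono _ _ yx _ Fu)|exact: gE].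
    * by rewrite gE ?f0 //; exact: F0.
  + have [||D [g [eg FD Du gE]]] := @emb_glue_seg X x F h Xl ex mono.
    * by move=> y /H[].
    * by move=> y z yz zx; have [_ e _ _] := H z zx; exact: e.
    have [|f [ef fE]] := emb_ext eg (smF x).
      by move=> u /Du[y /mono yx]; exact: yx.
    exists f; split=> // [y yx u Fu|y yx|u Fu].
    * by rewrite fE ?(gE y) //; exact: FD Fu.
    * have [z [yz _] zx] := lm y yx; have [_ _ zn _] := H z zx.
      have [u Fu <-] := zn y yz; exists u; first exact: (mono _ _ zx _ Fu).
      by rewrite fE ?(gE z) //; exact: FD Fu.
    * have [y yx] := ex; have [_ _ _ y0] := H y yx; have Fy := F0 y u Fu.
      by rewrite fE ?(gE y) ?y0 //; exact: FD Fy.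
have Xi : exists x : X, True by case: lim.
have [|x y xy|f [ef fE]] := @emb_glue X F h Xi Xl mono.
- by move=> x; have [] := hP x.
- by have [_ e _ _] := hP y; exact: e.
have En : E `<=` f @` \bigcup_x F x.
  move=> e /nS[x <-]; have [y xy] := proj2 lim x.
  have [_ _ /(_ x xy)[u Fu <-] _] := hP y.
  by exists u; [exists y|rewrite (fE y)].
have [k [ek kE]] := emb_inv ef.
exists k; split; first exact: emb_sub ek smE En.
  move=> u Fu; have [_ _ _ e] := hP x0.
  by rewrite -{1}(e u Fu) -(fE x0) // kE //; exists x0.
by move=> _ [u /En[v Fv <-] <-]; rewrite kE.
Qed.

(** Back and forth for limit models of equal length. The inclusion of [F i0] in [G i0] starts it, so
    the two chains need not have the same first model. *)
Lemma limit_model_iso (I : woset) (F G : I -> set U) i0 :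
  limit_ordinal I -> [set: I] #<= [set: lam] ->
  (forall i j, wo_lt i j -> univ (F i) (F j)) ->
  (forall i j, wo_lt i j -> univ (G i) (G j)) ->
  (forall i, wo_le i0 i) -> F i0 `<=` G i0 ->
  exists f, emb f (\bigcup_i F i) /\ f @` (\bigcup_i F i) = \bigcup_i G i.
Proof.
move=> lim Il uF uG i0P FG0.
have mF i j (ij : wo_lt i j) := univ_incl (uF i j ij).
have mG i j (ij : wo_lt i j) := univ_incl (uG i j ij).
have smF i : sm (F i).
  by have [j [ij _]] := wo_cof_limit i lim; have [] := univ_sm (uF i j ij).
have smG i : sm (G i).
  by have [j [ij _]] := wo_cof_limit i lim; have [] := univ_sm (uG i j ij).
have mG' i j : wo_le i j -> G i `<=` G j by move=> /wo_le_eqVlt[->//|/mG].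
pose Pr (h : I -> U -> U) i := [/\ emb (h i) (F i),
  forall j, wo_lt j i -> forall u, F j u -> h i u = h j u,
  forall k, wo_lt i k -> h i @` F i `<=` G k
  & forall j, wo_lt j i -> G j `<=` h i @` F i].
have [|h i H|h hP] := @wo_rec I _ id Pr.
- move=> h h' i e [p1 p2 p3 p4]; rewrite /Pr -(e i) ?wo_refl //; split=> // j ji u Fu.
  by rewrite (p2 _ ji) // e //; exact: wo_ltW.
- suff [f [ef fE fG Gf]] : exists f, [/\ emb f (F i),
      forall j, wo_lt j i -> forall u, F j u -> f u = h j u,
      forall k, wo_lt i k -> f @` F i `<=` G k
      & forall j, wo_lt j i -> G j `<=` f @` F i].
    exists f; rewrite /Pr; case: asboolP => // _; split=> // j ji.
    by case: asboolP => [e|_]; [case: (wo_lt_neq ji)|exact: fE].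
  have [i' si'] := wo_cof_limit i lim.
  have Gi' (f : U -> U) : f @` F i `<=` G i' -> forall k, wo_lt i k -> f @` F i `<=` G k.
    by move=> fG k ik; apply: subset_trans fG (mG' _ _ (wo_succ_le si' ik)).
  have [ii' _] := si'.
  have [im|[j sj]|[ex lm]] := wo_cases i.
  + have nx y : ~ wo_lt y i by move=> /wo_ltP; apply; exact: im.
    exists id; split; [exact: emb_id| | |]; try by move=> y /nx.
    move=> k ik _ [u Fu <-]; have e : i = i0 by exact: wo_anti.
    by apply: (mG' i0 k) => //; apply: FG0; rewrite -e.
  + have [ji jm] := sj; have [ef fE fG Gf] := H j ji; set f := h j in ef fE fG Gf.
    have [fi [efi fiE]] := emb_inv ef.
    (* Back: [g] takes [G i] into [F i] and inverts [f]. Forth: [k] takes [F i] into the next [G i']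
       and inverts [g], so it extends [f] and its image contains [G i]. *)
    have [|g [eg gE gF]] := univ_ext (uF j i ji) efi _ (smG i) (fG i ji).
      by move=> _ [_ [u Fu <-] <-]; rewrite fiE.
    have [gi [egi giE]] := emb_inv eg.
    have [|k [ek kE kG]] := univ_ext (uG i i' ii') egi _ (smF i) gF.
      by move=> _ [_ [u Gu <-] <-]; rewrite giE.
    have kf u : F j u -> k u = f u.
      move=> Fu; have Gfu : G i (f u) by apply: (fG i ji); exists u.
      have eu : g (f u) = u by rewrite gE ?fiE //; exists u.
      by rewrite -{1}eu kE ?giE //; exists (f u).
    exists k; split=> // [l li u Fu||l li x Gx].
    * have /wo_le_eqVlt[e|lj] := jm l li; first by rewrite e in Fu *; exact: kf.
      by rewrite kf ?(fE l) //; exact: (mF _ _ lj _ Fu).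
    * exact: Gi'.
    * have Gix := mG _ _ li _ Gx; exists (g x); first by apply: gF; exists x.
      by rewrite kE ?giE //; exists x.
  + have [||D [g [eg FD Du gE]]] := @emb_glue_seg I i F h Il ex mF.
    * by move=> j /H[].
    * by move=> j k jk ki; have [_ e _ _] := H k ki; exact: e.
    have [||f [ef fE fG]] := univ_ext (uG i i' ii') eg _ (smF i).
    * move=> _ [u /Du[j ji Fu] <-]; rewrite (gE j) //.
      by have [_ _ jG _] := H j ji; apply: (jG i ji); exists u.
    * by move=> u /Du[j /mF ji]; exact: ji.
    exists f; split=> // [j ji u Fu||j ji x Gx].
    * by rewrite fE ?(gE j) //; exact: FD Fu.
    * exact: Gi'.
    * have [k [jk _] ki] := lm j ji; have [_ _ _ /(_ j jk x Gx)[u Fu <-]] := H k ki.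
      exists u; first exact: (mF _ _ ki _ Fu).
      by rewrite fE ?(gE k) //; exact: FD Fu.
have Ii : exists i : I, True by case: lim.
have [|i j ij|f [ef fE]] := @emb_glue I F h Ii Il mF.
- by move=> i; have [] := hP i.
- by have [_ e _ _] := hP j; exact: e.
exists f; split=> //; apply/seteqP; split=> x.
  move=> [u [i _ Fu] <-]; have [k ik] := proj2 lim i; have [_ _ iG _] := hP i.
  by exists k => //; apply: (iG k ik); exists u => //; rewrite (fE i).
move=> [j _ Gx]; have [i ji] := proj2 lim j; have [_ _ _ /(_ j ji x Gx)[u Fu <-]] := hP i.
by exists u; [exists i|rewrite (fE i)].
Qed.

(** * Towers *)

(** Weak uniqueness cannot be applied at the union, which may leave [K']. It is applied at each
    [F i] with [i] at least [i0], and [NF_cont] passes to the union. *)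
Lemma eqtp_limit (I : woset) (F : I -> set U) i0 A a r : limit_ordinal I ->
  [set: I] #<= [set: lam] -> (forall i j, wo_lt i j -> univ (F i) (F j)) ->
  univ A (F i0) -> (forall i, wo_le i0 i -> NF A a (F i)) ->
  (forall i, wo_le i0 i -> NF A r (F i)) -> eqtp (F i0) a r ->
  eqtp (\bigcup_i F i) a r.
Proof.
move=> lim Il uF uA nfa nfr ar.
have F0 i : wo_le i0 i -> F i0 `<=` F i.
  by move=> /wo_le_eqVlt[->//|/uF/univ_incl].
pose S := wo_sub (fun i => wo_le i0 i).
have -> : \bigcup_i F i = \bigcup_(s : S) F (sval s).
  apply/seteqP; split=> u; last by case=> s _ Fu; exists (sval s).
  case=> i _ Fu; have [i0i|/uF/univ_incl ii0] := wo_leVlt i0 i.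
    by exists (exist _ i i0i).
  by exists (exist _ i0 (wo_refl i0)) => //; exact: ii0.
have A0 := univ_incl uA.
apply: NF_cont.
- split; first by exists (exist _ i0 (wo_refl i0)).
  move=> [i i0i]; have [j ij] := proj2 lim i.
  exists (exist _ j (wo_le_trans i0i (wo_ltW ij))); exact/wo_sub_ltE.
- exact: seg_card.
- by move=> s t /wo_sub_ltE; exact: uF.
- move=> [i i0i] /=; have nf := nfa i i0i; have [_ kF AF _] := NF_dom nf.
  exact: NF_base nf kF AF _.
- move=> [i i0i] /=; have [_ k0 _ _] := NF_dom (nfa i0 (wo_refl i0)).
  by apply: (NF_uniq uA k0 (F0 i i0i)) => //; [exact: nfa|exact: nfr].
Qed.

(** Weak extension is applied at one member [F i0] only; by [eqtp_limit] the point found for [B]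
    still realizes the type over the whole union. If [I] has a last element, that member is used
    instead. *)
Lemma NF_chain_ext (I : woset) (F : I -> set U) i0 A a B :
  [set: I] #<= [set: lam] -> (forall i j, wo_lt i j -> univ (F i) (F j)) ->
  univ A (F i0) -> (forall i, wo_le i0 i -> NF A a (F i)) -> ks B ->
  \bigcup_i F i `<=` B -> exists r, NF A r B /\ eqtp (\bigcup_i F i) a r.
Proof.
move=> Il uF uA nfa kB FB.
have kF i (i0i : wo_le i0 i) : ks (F i) by have [] := NF_dom (nfa i i0i).
have F0 i : wo_le i0 i -> F i0 `<=` F i.
  by move=> /wo_le_eqVlt[->//|/uF/univ_incl].
have FA i : F i `<=` B by apply: subset_trans FB; exact: bigcup_sup.
have [lim|nlim] := pselect (limit_ordinal I).
  have [r [nfr ra]] := NF_ext uA (nfa i0 (wo_refl i0)) kB (FA i0).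
  exists r; split=> //; apply: (eqtp_limit (i0 := i0) lim Il uF uA nfa).
    move=> i i0i; apply: (NF_mono nfr (kF i i0i)) => //.
    exact: subset_trans (univ_incl uA) (F0 i i0i).
  exact: eqtp_sym.
have [m mP] : exists m : I, forall i, wo_le i m.
  apply: contrapT => n; apply: nlim; split; first by exists i0.
  move=> i; apply: contrapT => n'; apply: n; exists i => j.
  by have [//|ij] := wo_leVlt j i; case: n'; exists j.
have -> : \bigcup_i F i = F m.
  apply/seteqP; split=> u; last by exists m.
  by case=> i _; have /wo_le_eqVlt[->//|/uF/univ_incl] := mP i; exact.
have uAm : univ A (F m) := univ_supr uA (ks_sm (kF m (mP i0))) (F0 m (mP i0)).
have [r [nfr ra]] := NF_ext uAm (nfa m (mP i0)) kB (FA m).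
by exists r; split=> //; exact: eqtp_sym.
Qed.

Section TowerExtension.
Context (G X : woset) (M_ : G -> X -> set U) (act : X -> Prop) (a : X -> U)
  (b : X -> set U).
Context (G_inh : exists g : G, True) (G_lam : [set: G] #<= [set: lam])
  (X_lim : limit_ordinal X) (X_lam : [set: X] #<= [set: lam]).
Context (M_ks : forall (g : G) x, ks (M_ g x))
  (M_mono : forall (g : G) x y, wo_lt x y -> M_ g x `<=` M_ g y)
  (M_univ : forall (g g' : G) x, wo_lt g g' -> univ (M_ g x) (M_ g' x))
  (M_act : forall x, act x -> exists g : G, [/\ univ (b x) (M_ g x),
    forall y, wo_lt x y -> M_ g y (a x)
    & forall g' : G, wo_le g g' -> NF (b x) (a x) (M_ g' x)]).

(** Level [x] of the union of the given chain of towers, possibly outside [K']; this is why [M_act]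
    asserts nonforking over the [M_ g x] only. *)
Let D x := \bigcup_g M_ g x.

Let smD x : sm (D x).
Proof.
apply: sm_chain => // [g h /M_univ u|g]; first exact: univ_incl (u x).
exact: ks_sm.
Qed.

Let DM x y : wo_lt x y -> D x `<=` D y.
Proof. by move=> /M_mono xy u [g _ Mu]; exists g => //; exact: xy. Qed.

Let act_D x y : act x -> wo_lt x y -> D y (a x).
Proof. by move=> /M_act[g [_ ax _]] /ax Ma; exists g. Qed.

Let b_D x : act x -> b x `<=` D x.
Proof. by move=> /M_act[g [/univ_incl bM _ _]] u /bM Mu; exists g. Qed.

(* The type of a(y) is nonforking over b(y), so its image under f extends to a
   nonforking type over m, whose realization is the new image of a(y). *)
Let tower_succ y x f m : wo_lt y x -> emb f (D y) -> ks m -> f @` D y `<=` m ->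
  exists g, [/\ emb g (D x), forall u, D y u -> g u = f u
    & act y -> NF (g @` b y) (g (a y)) m].
Proof.
move=> yx ef km fm.
have [acty|n] := pselect (act y); last first.
  have [g [eg gE]] := emb_ext ef (smD x) (DM yx).
  by exists g; split.
have [k [ek kf [l [el lk lf]]]] := emb_inv_ext ef (ks_sm km) fm.
have kB := ks_emb km ek.
have DB : D y `<=` k @` m.
  by move=> u Du; exists (f u); [apply: fm; exists u|exact: kf].
have [g0 [uby aM nfy]] := M_act acty.
have [r [nfr ar]] := NF_chain_ext (F := fun g : G => M_ g y) G_lam
  (fun _ _ gg' => M_univ y gg') uby nfy kB DB.
have [_ _ _ Cr] := NF_dom nfr.
have [Q [/ks_sm smQ BQ Qr _]] := cover1 (ks_sm kB) Cr.
have [l' [el' l'E]] := emb_ext el smQ BQ.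
have [||g [eg gE ga]] := emb_realize (f := f) ar (smD x) (DM yx) (act_D acty yx) el' _ Qr.
- exact: subset_trans BQ.
- by move=> u Du; rewrite l'E ?lf //; exact: DB.
exists g; split=> // _.
have nf := NF_emb nfr el' BQ Qr.
rewrite ga; suff -> : g @` b y = l' @` b y.
  suff e : l' @` (k @` m) = m by rewrite e in nf.
  apply/seteqP; split=> u.
    by case=> _ [v mv <-] <-; rewrite l'E ?lk //; exists v.
  by move=> mu; exists (k u); [exists u|rewrite l'E ?lk //; exists u].
have bD := b_D acty.
apply/seteqP; split=> _ [u bu <-]; exists u => //; rewrite gE ?l'E ?lf //.
all: by try apply: DB; apply: bD.
Qed.

(** The recursion builds pairs [h x] of an embedding of [D x] into [C] and a model of [K'] universal
    over its image and over the earlier models. The image of [a y] is fixed only after the model at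
    [y], which allows [tower_succ] to make it independent from that model. The inverse of the union
    of the embeddings finally brings the models back above the original levels. *)
Lemma tower_extension : exists M' : X -> set U,
  [/\ forall x, ks (M' x), forall x y, wo_lt x y -> univ (M' x) (M' y),
      forall x, univ (\bigcup_g M_ g x) (M' x)
    & forall x, act x -> NF (b x) (a x) (M' x)].
Proof.
pose Pr (h : X -> (U -> U) * set U) x := [/\ emb (h x).1 (D x),
  forall y, wo_lt y x -> forall u, D y u -> (h x).1 u = (h y).1 u,
  forall y, wo_lt y x -> act y -> NF ((h x).1 @` b y) ((h x).1 (a y)) (h y).2,
  ks (h x).2 & univ ((h x).1 @` D x) (h x).2 /\
    forall y, wo_lt y x -> univ (h y).2 (h x).2].
have [|h x H|h hP] := @wo_rec X _ (id, set0) Pr.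
- move=> h h' x e [p1 p2 p3 p4 [p5 p6]]; rewrite /Pr -(e x) ?wo_refl //.
  split=> // [y yx u Du|y yx acty|].
  + by rewrite (p2 y) // e //; exact: wo_ltW.
  + by rewrite -e; [exact: p3|exact: wo_ltW].
  + by split=> // y yx; rewrite -e; [exact: p6|exact: wo_ltW].
- have [f [ef fE fNF]] : exists f, [/\ emb f (D x),
      forall y, wo_lt y x -> forall u, D y u -> f u = (h y).1 u
      & forall y, wo_lt y x -> act y -> NF (f @` b y) (f (a y)) (h y).2].
    (* Independence of the image of [a z] from the model at [z] depends only on the embedding at a
       level above [z], so it survives later extensions. *)
    have transfer z y f : wo_lt z y -> wo_lt y x -> act z ->
        (forall u, D y u -> f u = (h y).1 u) -> NF (f @` b z) (f (a z)) (h z).2.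
      move=> zy yx actz fE; have [_ _ nf _ _] := H y yx.
      rewrite fE; last exact: act_D.
      suff -> : f @` b z = (h y).1 @` b z by exact: nf.
      have bD : b z `<=` D y by apply: subset_trans (b_D actz) (DM zy).
      by apply/seteqP; split=> _ [u bu <-]; exists u => //; rewrite fE //; exact: bD.
    have [xm|[y [yx ym]]|[ex lm]] := wo_cases x.
    + have nx y : ~ wo_lt y x by move=> /wo_ltP; apply; exact: xm.
      by exists id; split; [exact: emb_id| |]; move=> y /nx.
    + have [ef fE fNF km [um mm]] := H y yx.
      have [g [eg gE gNF]] := tower_succ yx ef km (univ_incl um).
      exists g; split=> // z zx.
        have [->//|zy] := wo_le_eqVlt (ym z zx).
        by move=> u Du; rewrite gE ?(fE z) //; exact: DM zy _ Du.
      have [->//|zy] := wo_le_eqVlt (ym z zx).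
      by move=> actz; exact: (transfer z y).
    + have [||E [g [eg FE Eu gE]]] := @emb_glue_seg X x D (fun y => (h y).1) X_lam ex DM.
      * by move=> y /H[].
      * by move=> y z yz zx; have [_ e _ _ _] := H z zx; exact: e.
      have [|f [ef fE]] := emb_ext eg (smD x).
        by move=> u /Eu[y /DM yx]; exact: yx.
      have fE' y : wo_lt y x -> forall u, D y u -> f u = (h y).1 u.
        by move=> yx u Du; rewrite fE ?(gE y) //; exact: FE Du.
      exists f; split=> // y yx acty; have [z [yz _] zx] := lm y yx.
      exact: transfer yz zx acty (fE' z zx).
  have [||m [km Am um]] := @cover (f @` D x `|` \bigcup_(y in [set y | wo_lt y x]) (h y).2).
  + move=> u [|[y yx hu]]; first exact: (sm_C (emb_img ef)).
    by have [_ _ _ km _] := H y yx; exact: sm_C (ks_sm km) _ hu.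
  + apply: card_leU => //; first exact: sm_card (emb_img ef).
    have -> : \bigcup_(y in [set y | wo_lt y x]) (h y).2 =
        \bigcup_(s : wo_sub (fun y => wo_lt y x)) (h (sval s)).2.
      apply/seteqP; split=> u; first by case=> y yx hu; exists (exist _ y yx).
      by case=> -[y yx] _ hu; exists y.
    apply: card_le_bigcup => //; first exact: seg_card.
    by move=> [y yx]; have [_ _ _ km _] := H y yx; exact: sm_card (ks_sm km).
  exists (f, m); rewrite /Pr; case: asboolP => // _ /=; split=> //.
  + move=> y yx; case: asboolP => [e|_]; [by case: (wo_lt_neq yx)|exact: fE].
  + move=> y yx; case: asboolP => [e|_]; [by case: (wo_lt_neq yx)|exact: fNF].
  + split; first by apply: um; [exact: emb_img|move=> u ?; left].
    move=> y yx; case: asboolP => [e|_]; first by case: (wo_lt_neq yx).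
    have [_ _ _ ky _] := H y yx; apply: um; first exact: ks_sm.
    by move=> u hu; right; exists y.
have Xi : exists x : X, True by case: X_lim.
have [|x y xy|f [ef fE]] := @emb_glue X D (fun x => (h x).1) Xi X_lam DM.
- by move=> x; have [] := hP x.
- by have [_ e _ _ _] := hP y; exact: e.
have [g [eg gE]] := emb_inv ef.
have kh x : ks (h x).2 by have [] := hP x.
(* A model containing all the new levels, to which the inverse [g] is extended. *)
have [||Q [/ks_sm smQ AQ _]] := @cover (f @` (\bigcup_x D x) `|` \bigcup_x (h x).2).
- move=> u [|[x _]]; first exact: (sm_C (emb_img ef)).
  exact: sm_C (ks_sm (kh x)) _.
- apply: card_leU => //; first exact: sm_card (emb_img ef).
  by apply: card_le_bigcup => // x; exact: sm_card (ks_sm (kh x)).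
have [k [ek kE]] := emb_ext eg smQ (fun u fu => AQ u (or_introl fu)).
have hQ x : (h x).2 `<=` Q by move=> u hu; apply: AQ; right; exists x.
have kf x u : D x u -> k ((h x).1 u) = u.
  move=> Du; rewrite -(fE x) // kE ?gE //; first by exists x.
  by exists u => //; exists x.
have ekh x : emb k (h x).2 by apply: emb_sub ek (ks_sm (kh x)) (hQ x).
have kD x A : A `<=` D x -> k @` ((h x).1 @` A) = A.
  move=> AD; apply/seteqP; split=> u; first by case=> _ [v /[dup] Av /AD Dv <-] <-; rewrite kf.
  by move=> Au; exists ((h x).1 u); [exists u|rewrite (kf x) //; exact: AD].
exists (fun x => k @` (h x).2); split.
- by move=> x; exact: ks_emb.
- move=> x y xy; apply: univ_emb => //.
  by have [_ _ _ _ [_ u]] := hP y; exact: u.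
- move=> x; have [_ _ _ _ [u _]] := hP x.
  by have := univ_emb u (ekh x); rewrite kD.
- move=> x actx; have [y [xy _]] := wo_cof_limit x X_lim.
  have [ey _ nf _ _] := hP y.
  have hay : Q ((h y).1 (a x)).
    apply: AQ; left; exists (a x); first by exists y => //; exact: act_D.
    by rewrite (fE y) //; exact: act_D.
  have := NF_emb (nf x xy actx) ek (hQ x) hay.
  rewrite kD; last exact: subset_trans (b_D actx) (DM xy).
  by rewrite (kf y) //; exact: act_D.
Qed.

End TowerExtension.

(** * A reduced chain of towers *)

Section ReducedChain.
Context (I Lam : woset) (Lam_lam : wo_sort Lam = lam) (I_lim : limit_ordinal I)
  (I_lam : [set: I] #<= [set: lam]) (I_cf : cf_ge I kappa).
Context (A0 : set U) (kA0 : ks A0).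

Let T := wo_lex I Lam.
(* The point (b, (beta, (gamma, xi))) of X is a slot of the block b, reserved for an
   element which is chosen at time gamma and realizes the xi-th type over the
   model at the bottom of the block, if that type does not fork over the
   bottom of the same block at time beta. *)
Let S := wo_lex T (wo_lex T Lam).
Let X := wo_lex T S.

Let Lam_inh : exists l : Lam, True.
Proof. by rewrite Lam_lam; exact: lam_inh. Qed.

Let Lam_le : [set: Lam] #<= [set: lam].
Proof. by rewrite Lam_lam. Qed.

Let T_lim : limit_ordinal T.
Proof. exact: wo_lex_limit. Qed.

Let T_lam : [set: T] #<= [set: lam].
Proof. exact: card_le_prod. Qed.

Let lam_T : [set: lam] #<= [set: T].
Proof.
have [[i _] _] := I_lim; rewrite -Lam_lam.
by apply/card_leTP; exists (fun l => (i, l)) => l l' [].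
Qed.

Let T_cf : cf_ge T kappa.
Proof. exact: wo_lex_cf_ge. Qed.

Let T_inh : exists t : T, True.
Proof. by case: T_lim. Qed.

Let S_inh : exists s : S, True.
Proof. by have [t _] := T_inh; have [l _] := Lam_inh; exists (t, (t, l)). Qed.

Let X_lim : limit_ordinal X.
Proof. exact: wo_lex_limit. Qed.

Let X_lam : [set: X] #<= [set: lam].
Proof. by do 3 apply: card_le_prod => //. Qed.

Context (s0 : S) (s0P : forall s, wo_le s0 s) (t0 : T) (t0P : forall t, wo_le t0 t).
Context (ty : set U -> Lam -> U)
  (tyP : forall A r, sm A -> dom C r -> exists l, eqtp A (ty A l) r).
Context (en : set U -> Lam -> U)
  (enP : forall A c, A #<= [set: lam] -> A c -> exists l, en A l = c).

Let base (x : X) : T := x.2.1.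
Let time (x : X) : T := x.2.2.1.
Let bot (t : T) : X := (t, s0).

Let bot_le (x : X) : wo_le (bot x.1) x.
Proof.
have [//|/wo_lex_ltE[|[_ /=]]] := wo_leVlt (bot x.1) x; first by move=> /wo_lt_irr.
by move=> /wo_ltP; case; exact: s0P.
Qed.

Let bot_lt (x : X) (t : T) : wo_lt x.1 t -> wo_lt x (bot t).
Proof. by move=> xt; apply/wo_lex_ltE; left. Qed.

(** The tower at each time, together with the points chosen then; the second component is consulted
    at [x] only when [time x] is that time. *)
Let history := T -> (X -> set U) * (X -> U).
Implicit Type (H : history).

(** The slots that receive a point with a nonforking type. The strict inequality makes the model at
    time [time x] universal over the base, as weak uniqueness and weak extension demand. *)
Let live H x := wo_lt (base x) (time x) /\
  NF ((H (base x)).1 (bot x.1)) (ty ((H (time x)).1 (bot x.1)) x.2.2.2)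
     ((H (time x)).1 (bot x.1)).

(** [W] is an admissible tower after the times in [Q]. The recursion takes [Q] to be the times
    before [t]; the final extension takes all times. *)
Let ext H (Q : T -> Prop) (W : X -> set U) := [/\ forall x, ks (W x),
  forall x y, wo_lt x y -> univ (W x) (W y),
  forall t, Q t -> forall x, univ ((H t).1 x) (W x),
  forall x, Q (time x) -> live H x ->
    NF ((H (base x)).1 (bot x.1)) ((H (time x)).2 x) (W x)
  & forall x, A0 `<=` W x].

(* As t.2 varies, this runs through the points of the towers built at the times
   with first component less than t.1. *)
Let goal H (t : T) :=
  en [set c | exists (u : T) x, wo_lt u.1 t.1 /\ (H u).1 x c] t.2.

(** The last clause is the greedy choice: the tower at [t] is compared with every [W] that could
    have been taken in its place. *)
Let Pr H (t : T) := [/\ ext H (fun u => wo_lt u t) (H t).1,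
  forall x, time x = t -> live H x ->
    [/\ forall y, wo_lt x y -> (H t).1 y ((H t).2 x),
        eqtp ((H t).1 (bot x.1)) ((H t).2 x) (ty ((H t).1 (bot x.1)) x.2.2.2)
      & NF ((H (base x)).1 (bot x.1)) ((H t).2 x) ((H t).1 x)]
  & forall W, ext H (fun u => wo_lt u t) W -> W (bot t0) (goal H t) ->
      (H t).1 (bot t0) (goal H t)].

Let live_loc H H' x : (forall t, wo_le t (time x) -> H t = H' t) -> live H x -> live H' x.
Proof. by move=> e [bt nf]; rewrite /live -!e ?wo_refl //; exact: wo_ltW. Qed.

Let ext_loc H H' (Q : T -> Prop) W : (forall t, Q t -> H t = H' t) ->
  (forall s t, wo_le s t -> Q t -> Q s) -> ext H Q W -> ext H' Q W.
Proof.
move=> e Qd [p1 p2 p3 p4 p5]; split=> // [t Qt x|x Qx l].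
  by rewrite -e //; exact: p3.
have lH : live H x by apply: live_loc l => t tx; rewrite e //; exact: Qd tx Qx.
have [bt _] := l; rewrite -!e //; first exact: p4.
exact: Qd (wo_ltW bt) Qx.
Qed.

Let goal_loc H H' t : (forall u, wo_lt u t -> H u = H' u) -> goal H t = goal H' t.
Proof.
move=> e; rewrite /goal; congr (en _ _); apply/seteqP.
have lt (u : T) : wo_lt u.1 t.1 -> wo_lt u t by move=> ut; apply/wo_lex_ltE; left.
by split=> c [u [x [ut Hc]]]; exists u, x; split=> //; move: Hc; rewrite e //; exact: lt.
Qed.

(** [tower_extension] applied to the chain of towers at the times in [Q]. The second conclusion
    yields universality over the union of all bottom models. *)
Let ext_ex H (Q : T -> Prop) : (forall t, Q t -> Pr H t) ->
  (forall s t, wo_le s t -> Q t -> Q s) ->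
  exists W : X -> set U, ext H Q W /\ forall A, sm A -> (exists t, Q t) ->
    (forall c, A c -> exists2 t, Q t & (H t).1 (bot t0) c) -> univ A (W (bot t0)).
Proof.
move=> HP Qd; have [[q Qq]|nQ] := pselect (exists t, Q t); last first.
  (* Without earlier times, the chain consists of one constant tower with no active position. *)
  pose G := wo_sub (fun t : T => t = t0); have g0 : G by exists t0.
  have [|||g g' x|g []|W [p1 p2 p3 _]] := @tower_extension G X (fun _ _ => A0) (fun=> False)
    (fun=> ty A0 t0.2) (fun=> A0) _ _ X_lim X_lam (fun _ _ => kA0).
  - by exists g0.
  - exact: seg_card.
  - by move=> g x y _ u.
  - move=> /wo_sub_ltE/wo_lt_neq; case: g g' => [g eg] [g' eg'] /=.
    by rewrite eg eg'.
  exists W; split; last by move=> A _ /nQ.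
  split=> // [t Qt|x Qx|x u Au]; try by case: nQ; eexists; eassumption.
  by apply: (univ_incl (p3 x)); exists g0.
pose G := wo_sub Q.
have [|||||x [Qx lx]|W [p1 p2 p3 p4]] := @tower_extension G X (fun (g : G) x => (H (sval g)).1 x)
  (fun x => Q (time x) /\ live H x) (fun x => (H (time x)).2 x)
  (fun x => (H (base x)).1 (bot x.1)) _ _ X_lim X_lam.
- by exists (exist _ q Qq).
- exact: seg_card.
- by move=> [t Qt] x /=; have [[]] := HP t Qt.
- by move=> [t Qt] x y xy /=; have [[_ m _ _ _] _ _] := HP t Qt; exact: univ_incl (m x y xy).
- move=> [s Qs] [t Qt] x /wo_sub_ltE /= st; have [[_ _ u _ _] _ _] := HP t Qt; exact: u.
- exists (exist _ (time x) Qx); have [[k1 k2 k3 k4 k5] aP _] := HP _ Qx.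
  have [bt _] := lx; have [a1 a2 a3] := aP x erefl lx; split=> //.
    apply: univ_supr (k3 _ bt _) (ks_sm (k1 x)) _.
    by have /wo_le_eqVlt[->//|/k2/univ_incl] := bot_le x; exact.
  move=> [t Qt] /wo_sub_leE/wo_le_eqVlt[<-//|xt].
  by have [[_ _ _ nf _] _ _] := HP t Qt; exact: nf.
have sub t x : Q t -> (H t).1 x `<=` \bigcup_(g : G) (H (sval g)).1 x.
  by move=> Qt u Hu; exists (exist _ t Qt).
exists W; split.
  split=> // [t Qt x|x Qx lx|x u Au].
  - have [[kt _ _ _ _] _ _] := HP t Qt.
    by apply: univ_subl (p3 x); [exact: ks_sm|exact: sub].
  - exact: p4.
  - apply: (univ_incl (p3 x)); apply: (sub q x Qq).
    by have [[_ _ _ _ k5] _ _] := HP q Qq; exact: k5.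
move=> A smA _ AH; apply: univ_subl (p3 _) => //.
by move=> c /AH[t Qt Hc]; exact: sub Qt _ Hc.
Qed.

Let history_ex : exists H, forall t, Pr H t.
Proof.
have [l _] := Lam_inh.
apply: (@wo_rec T _ (fun=> A0, fun=> ty A0 l) Pr) => [H H' t e [p1 p2 p3]|H t HP].
  have elt u : wo_lt u t -> H u = H' u by move=> /wo_ltW; exact: e.
  have dn s u : wo_le s u -> wo_lt u t -> wo_lt s t by exact: wo_le_lt_trans.
  have et := e t (wo_refl t).
  rewrite /Pr -et; split.
  - exact: ext_loc p1.
  - move=> x xt lx; have lH : live H x.
      by apply: live_loc lx => u ut; rewrite e // -xt.
    have [bt _] := lx; have [a1 a2 a3] := p2 x xt lH; split=> //.
    by rewrite -elt // -xt.
  - move=> W eW; rewrite -(goal_loc elt); apply: p3.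
    by apply: ext_loc eW => // u ut; rewrite elt.
have dn s u : wo_le s u -> wo_lt u t -> wo_lt s t by exact: wo_le_lt_trans.
(* [W] takes the goal into its bottom model whenever some admissible tower does. *)
have [W [eW gW]] : exists W : X -> set U, ext H (fun u => wo_lt u t) W /\
    forall W', ext H (fun u => wo_lt u t) W' -> W' (bot t0) (goal H t) ->
      W (bot t0) (goal H t).
  have [[W [eW gW]]|n] := pselect (exists W, ext H (fun u => wo_lt u t) W /\
    W (bot t0) (goal H t)); first by exists W.
  have [W [eW _]] := ext_ex HP dn; exists W; split=> // W' eW' gW'.
  by case: n; exists W'.
have [w1 w2 w3 w4 w5] := eW.
(* The prescribed type over the bottom of the block is extended to a nonforking type over level [x],
   which is realized in the next level. *)
have /choice[a aP] : forall x, exists a, wo_lt (base x) t ->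
    NF ((H (base x)).1 (bot x.1)) (ty (W (bot x.1)) x.2.2.2) (W (bot x.1)) ->
    [/\ forall y, wo_lt x y -> W y a, eqtp (W (bot x.1)) a (ty (W (bot x.1)) x.2.2.2)
      & NF ((H (base x)).1 (bot x.1)) a (W x)].
  move=> x; have [[bt nf]|n] := pselect (wo_lt (base x) t /\
    NF ((H (base x)).1 (bot x.1)) (ty (W (bot x.1)) x.2.2.2) (W (bot x.1))); last first.
    by exists (ty A0 l) => bt nf; case: n.
  have bW : W (bot x.1) `<=` W x.
    by have /wo_le_eqVlt[->//|/w2/univ_incl] := bot_le x; exact.
  have [r [nfr rt]] := NF_ext (w3 _ bt _) nf (w1 x) bW.
  have [y [xy yP]] := wo_cof_limit x X_lim.
  have [_ _ _ Cr] := NF_dom nfr.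
  have [a Wa ar] := univ_realize (w2 x y xy) Cr.
  exists a => _ _; split.
  - move=> z xz; have /wo_le_eqVlt[<-//|/w2/univ_incl yz] := wo_succ_le (conj xy yP) xz.
    exact: yz.
  - by apply: eqtp_trans rt; apply: eqtp_sub bW ar; exact: ks_sm.
  - by apply: NF_eqtp nfr _; exact: eqtp_sym.
exists (W, a); set H' := fun _ => _.
have Ht : H' t = (W, a) by rewrite /H'; case: asboolP.
have Hlt u : wo_lt u t -> H' u = H u.
  by move=> ut; rewrite /H'; case: asboolP => // e; case: (wo_lt_neq ut).
rewrite /Pr Ht /=; split.
- by apply: ext_loc eW => // u ut; rewrite Hlt.
- by move=> x xt [bt]; rewrite xt in bt *; rewrite Ht Hlt //= => nf; exact: aP.
- move=> V eV; rewrite (goal_loc Hlt); apply: gW.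
  exact: ext_loc eV.
Qed.

(** [P] consists of bottom models at cofinally many times, [M_] is the bottom of one more extension,
    and [N] is the union over all times of the bottom models of all blocks. *)
Lemma reduced_chain : exists (P : I -> set U) (M_ N : set U),
  [/\ (forall i j, wo_lt i j -> univ (P i) (P j)) /\ (forall i, A0 `<=` P i),
      univ (\bigcup_i P i) M_, sm N /\ \bigcup_i P i `<=` N,
      forall E, sm E -> \bigcup_i P i `<=` E -> exists g, [/\ emb g E,
        forall u, (\bigcup_i P i) u -> g u = u & g @` E `<=` N]
    & M_ `&` N `<=` \bigcup_i P i].
Proof.
have [H HP] := history_ex; have [l _] := Lam_inh; have [i0 _] := proj1 I_lim.
have tl (i j : I) (k k' : Lam) : wo_lt i j -> @wo_lt T (i, k) (j, k').
  by move=> ij; apply/wo_lex_ltE; left.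
have Hu s t x : wo_lt s t -> univ ((H s).1 x) ((H t).1 x).
  by move=> st; have [[_ _ u _ _] _ _] := HP t; exact: u.
have Hk t x : ks ((H t).1 x) by have [[]] := HP t.
have HM t x y : wo_lt x y -> univ ((H t).1 x) ((H t).1 y).
  by have [[_ m _ _ _] _ _] := HP t; exact: m.
pose F (b : T) := \bigcup_t (H t).1 (bot b).
have Hm s t x : wo_lt s t -> (H s).1 x `<=` (H t).1 x by move=> /Hu/univ_incl.
(* The times [(i, l)] with [l] fixed are cofinal in [T]; this thins the chain of bottom models to
   length [I]. *)
have PE : \bigcup_i (H (i, l)).1 (bot t0) = F t0.
  apply/seteqP; split=> u [t _ Hu']; first by exists (t, l).
  have [j tj] := proj2 I_lim t.1; exists j => //; apply: Hm Hu'.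
  by apply/wo_lex_ltE; left.
have smF b : sm (F b).
  by apply: sm_chain => // [s t|t]; [exact: Hm|exact: ks_sm].
have FM b b' : wo_lt b b' -> F b `<=` F b'.
  move=> bb u [t _ Hu']; exists t => //; apply: (univ_incl (HM t _ _ _)) Hu'.
  exact: bot_lt.
have [W [eW uW]] := ext_ex (Q := fun=> True) (fun t _ => HP t) (fun _ _ _ _ => Logic.I).
have [w1 w2 w3 w4 w5] := eW.
(* Local character along time gives [beta] such that the type of [r] over [F b] does not fork over
   the bottom of block [b] at time [beta]. The point in the slot for this type at a time [tm] after
   [beta] agrees with [r] over the bottom at [tm], hence over [F b] by [eqtp_limit]. *)
have types b b' r : wo_lt b b' -> dom C r -> exists2 a, F b' a & eqtp (F b) a r.
  move=> bb Cr.
  have [beta nfr] := NF_loc (F := fun t => (H t).1 (bot b)) T_lim T_lam T_cf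
    (fun t => Hk t _) (fun s t st => Hu s t _ st) Cr.
  have [tm btm] := proj2 T_lim beta.
  have [xi rxi] := tyP (ks_sm (Hk tm (bot b))) Cr.
  pose x : X := (b, (beta, (tm, xi))).
  have sup t : (H t).1 (bot b) `<=` F b by move=> u Hu'; exists t.
  have nfr' t : wo_le tm t -> NF ((H beta).1 (bot b)) r ((H t).1 (bot b)).
    move=> tmt; apply: NF_mono nfr (Hk t _) _ (sup t).
    by apply: Hm; exact: wo_lt_le_trans tmt.
  have lx : live H x.
    by split=> //=; apply: NF_eqtp (nfr' tm (wo_refl _)) _; exact: eqtp_sym.
  have [_ /(_ x erefl lx)[a1 a2 a3] _] := HP tm.
  exists ((H tm).2 x); first by exists tm => //; apply: a1; exact: bot_lt.
  have bx t : (H t).1 (bot b) `<=` (H t).1 x.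
    by have /wo_le_eqVlt[->//|/(HM t)/univ_incl] := bot_le x; exact.
  have nfa t : wo_le tm t -> NF ((H beta).1 (bot b)) ((H tm).2 x) ((H t).1 (bot b)).
    move=> tmt; suff nf : NF ((H beta).1 (bot b)) ((H tm).2 x) ((H t).1 x).
      apply: NF_mono nf (Hk t _) _ (bx t).
      by apply: Hm; exact: wo_lt_le_trans tmt.
    have /wo_le_eqVlt[<-//|tmt'] := tmt.
    by have [[_ _ _ nf _] _ _] := HP t; exact: (nf x).
  apply: (eqtp_limit (F := fun t => (H t).1 (bot b)) T_lim T_lam _ (Hu beta tm _ btm) nfa nfr').
    by move=> s t; exact: Hu.
  exact: eqtp_trans a2 rxi.
pose N := \bigcup_b F b.
have FN : F t0 `<=` N by exact: bigcup_sup.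
exists (fun i => (H (i, l)).1 (bot t0)), (W (bot t0)), N; rewrite PE; split.
- split=> [i j ij|i]; first by apply: Hu; exact: tl.
  by have [[_ _ _ _ h] _ _] := HP (i, l); exact: h.
- exact: uW.
- by split=> //; apply: sm_chain.
- by move=> E smE FE; exact: (universal_of_types T_lim T_lam lam_T FM smF types t0P smE FE).
(* A point [c] that appears at time [u] is the goal at some time [(i, k)] with [i] beyond [u.1]. As
   [W] was a candidate there and contains [c] in its bottom, [c] entered the bottom at that time. *)
- move=> c [Wc [b _ [u _ Hc]]].
  have [i ui] := proj2 I_lim u.1.
  set D := [set c | exists (v : T) x, wo_lt v.1 i /\ (H v).1 x c].
  have Dl : D #<= [set: lam].
    apply: (@card_le_trans _ _ _ (\bigcup_(p : T * X) (H p.1).1 p.2)).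
      by apply: subset_card_le => d [v [x [_ Hd]]]; exists (v, x).
    apply: card_le_bigcup => //; first exact: card_le_prod.
    by move=> p; apply: sm_card; exact: ks_sm.
  have [k kE] : exists k, en D k = c by apply: enP => //; exists u, (bot b).
  have [_ _ /(_ W)] := HP (i, k).
  rewrite /goal /= -/D kE => cW; exists (i, k) => //; apply: cW => //.
  by split=> // [t _|x _]; [exact: w3|exact: w4].
Qed.

End ReducedChain.

(** * Disjoint amalgamation *)

(** [A] is identified with the union [Q] of the chain [P]; then [B1] is sent into [M_] and [B2] into
    [N] over [Q], and these two meet only in [Q]. *)
Lemma disjoint_amalgam_sm (I : woset) (F : I -> set U) B1 B2 :
  limit_ordinal I -> [set: I] #<= [set: lam] -> cf_ge I kappa ->
  (forall i j, wo_lt i j -> univ (F i) (F j)) -> sm B1 -> sm B2 ->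
  \bigcup_i F i `<=` B1 -> \bigcup_i F i `<=` B2 -> exists g1 g2,
  [/\ emb g1 B1, emb g2 B2, forall u, (\bigcup_i F i) u -> g1 u = u /\ g2 u = u
    & (g1 @` B1) `&` (g2 @` B2) `<=` \bigcup_i F i].
Proof.
move=> lim Il cf uF sm1 sm2 AB1 AB2.
have Ii : exists i : I, True by case: lim.
have kA : ks (\bigcup_i F i).
  by apply: ks_chain => // i j /uF; exact: univ_incl.
set A := \bigcup_i F i in kA AB1 AB2 *.
have [Lam LamE] := woset_ex lam.
have [l0 _] := lam_inh lam_inf.
have [u0 _] : exists u : U, True.
  have [P [[_ KP _] _]] := kA.
  have /card_leTP[f _] : [set: nat] #<= [set: dom P].
    by rewrite (card_le_eqr (card_setT _)); exact: card_le_trans (Klam_ge KP).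
  by exists (set_val (f 0)).
have /choice[ty tyP] : forall D : set U, exists t : Lam -> U, sm D ->
    forall r, dom C r -> exists l, eqtp D (t l) r.
  move=> D; rewrite LamE; have [/type_enum[t tP]|n] := pselect (sm D); first by exists t.
  by exists (fun=> u0).
have /choice[en enP] : forall D : set U, exists e : Lam -> U, D #<= [set: lam] ->
    forall c, D c -> exists l, e l = c.
  move=> D; rewrite LamE; have [/(card_le_set l0)[f fI]|n] :=
    pselect (D #<= [set: lam] : Prop); last by exists (fun=> u0).
  have /choice[e eP] : forall l, exists c, forall d, D d -> f d = l -> c = d.
    move=> l; have [[d [Dd fd]]|n] := pselect (exists d, D d /\ f d = l).
      by exists d => d' Dd' fd'; apply: fI; rewrite ?fd ?fd' //; exact: mem_set.
    by exists u0 => d Dd fd; case: n; exists d.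
  by exists e => _ c Dc; exists (f c); exact: eP.
have Li : exists l : Lam, True by rewrite LamE; exists l0.
have [t0 t0P] : exists t : wo_lex I Lam, forall s, wo_le t s.
  by apply: wo_least; have [i _] := Ii; have [l _] := Li; exists (i, l).
have [s0 s0P] : exists s : wo_lex (wo_lex I Lam) (wo_lex (wo_lex I Lam) Lam),
    forall s', wo_le s s'.
  by apply: wo_least; have [l _] := Li; exists (t0, (t0, l)).
(* The first tower must lie in [K'], so it starts from [A] itself; since [A] contains [F i0],
   [limit_model_iso] still applies. *)
have [P [M_ [N [[uP AP] uM [smN PN] uN MN]]]] :=
  reduced_chain LamE lim Il cf kA s0P t0P (fun D r smD => tyP D smD r) (fun D c Dl => enP D Dl c).
have [i0 i0P] := wo_least Ii.
have [|f [ef fA]] := limit_model_iso lim Il uF uP i0P.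
  by apply: subset_trans (AP i0); exact: bigcup_sup.
set Q := \bigcup_i P i in fA uM PN uN MN; rewrite -/A in ef fA.
have [smQ smM] := univ_sm uM.
have [g1 [eg1 g1E]] := emb_ext ef sm1 AB1; have [g2 [eg2 g2E]] := emb_ext ef sm2 AB2.
have QI B g : A `<=` B -> (forall x, A x -> g x = f x) -> Q `<=` g @` B.
  by move=> AB gE u; rewrite -fA => -[x Ax <-]; exists x; [exact: AB|exact: gE].
have [|k1 [ek1 k1E k1M]] := univ_ext uM (emb_id smQ) _ (emb_img eg1) (QI _ _ AB1 g1E).
  by move=> _ [x Qx <-].
have [k2 [ek2 k2E k2N]] := uN _ (emb_img eg2) (QI _ _ AB2 g2E).
have [fi [efi fiE]] := emb_inv ef.
have [||E [/ks_sm smE MNE _]] := @cover (M_ `|` N).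
- by move=> x [/(sm_C smM)|/(sm_C smN)].
- by apply: card_leU => //; exact: sm_card.
have fAE : f @` A `<=` E by rewrite fA => x /PN Nx; apply: MNE; right.
(* [p] extends the inverse of [f] to a model containing [M_] and [N], so that the final embeddings
   fix [A]. *)
have [p [ep pE]] := emb_ext efi smE fAE.
have kE k B g (D : set U) : emb g B -> emb k (g @` B) -> k @` (g @` B) `<=` D ->
    D `<=` M_ `|` N -> emb (p \o (k \o g)) B.
  move=> eg ek kD DMN; apply: emb_comp; first exact: emb_comp.
  rewrite image_comp in kD *; apply: emb_sub ep _ _.
    by rewrite -image_comp; exact: emb_img.
  by move=> x /kD/DMN/MNE.
exists (p \o (k1 \o g1)), (p \o (k2 \o g2)); split.
- by apply: kE k1M _ => // x ?; left.
- by apply: kE k2N _ => // x ?; right.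
- move=> u Au /=; have Qf : Q (f u) by rewrite -fA; exists u.
  have pf : p (f u) = u by rewrite pE ?fiE //; exists u.
  by rewrite g1E // g2E // k1E // k2E.
- move=> _ [[x Bx <-] [y By /= e]].
  have Mx : M_ (k1 (g1 x)) by apply: k1M; exists (g1 x) => //; exists x.
  have Ny : N (k2 (g2 y)) by apply: k2N; exists (g2 y) => //; exists y.
  have exy : k2 (g2 y) = k1 (g1 x).
    by apply: (emb_inj ep _ _ e); apply: MNE; [right|left].
  have : Q (k1 (g1 x)) by apply: MN; split=> //; rewrite -exy.
  by rewrite -fA => -[z Az <-]; rewrite pE ?fiE //; exists z.
Qed.

(** Both extensions are first moved into [C] over [M]; the amalgam is [C] itself. *)
Lemma disjoint_amalgamation_limit (I : woset) (Ms : I -> structure L U) M :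
  ac_le K M C -> limit_ordinal I -> [set: I] #<= [set: lam] -> cf_ge I kappa ->
  universal_chain K lam Ms M -> disjoint_amalgamation_base K M.
Proof.
move=> MC lim Il cf [uMs uM [dM _ _]].
have [i0 _] := proj1 lim; have [_ KM _ _] := uM i0.
have mMs i : mdl (dom (Ms i)) (Ms i).
  by have [KMs _ le _] := uM i; apply: mdlP => //; exact: ac_le_trans MC.
have mM : mdl (dom M) M by [].
split; first by case: KM.
move=> M1 M2 c1 c2 MM1 MM2.
have into N : dom N #= dom M -> ac_le K M N -> exists k N',
    [/\ iso k N N', mdl (dom N') N', dom M `<=` dom N' & forall x, dom M x -> k x = x].
  move=> cN MN; have KN : Klam N.
    by split; [case: (ac_le_mem MN)|have [_ ?] := KM; exact: card_eq_trans cN _].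
  have [k [[N' iN N'C] kE]] := C_ext KM KN MN (embedding_id MC).
  exists k, N'; split=> //; first by split=> //; exact: Klam_iso iN KN.
  move=> x Mx; rewrite -(kE x Mx); apply: (iso_fun iN).
  by have [s _ _] := ac_le_sub MN; exact: s.
have [k1 [N1 [i1 m1 MN1 k1E]]] := into M1 c1 MM1.
have [k2 [N2 [i2 m2 MN2 k2E]]] := into M2 c2 MM2.
have [|||||g1 [g2 [eg1 eg2 gE gI]]] :=
  @disjoint_amalgam_sm I (fun i => dom (Ms i)) (dom N1) (dom N2) lim Il cf.
- by move=> i j ij; exists (Ms i), (Ms j); split=> //; exact: uMs.
- by exists N1.
- by exists N2.
- by rewrite -dM.
- by rewrite -dM.
rewrite -dM in gE gI.
have [N1' [j1 [N1'C _ _]]] := emb_iso eg1 m1; have [N2' [j2 [N2'C _ _]]] := emb_iso eg2 m2.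
exists C, (g1 \o k1), (g2 \o k2); split.
- split; first by exists N1' => //; exact: iso_comp i1 j1.
  by move=> x Mx /=; rewrite k1E //; have [] := gE x Mx.
- split; first by exists N2' => //; exact: iso_comp i2 j2.
  by move=> x Mx /=; rewrite k2E //; have [] := gE x Mx.
- apply/seteqP; split=> x.
    move=> [[y M1y <-] [z M2z e]]; apply: gI; split.
      by exists (k1 y) => //; exact: iso_fun i1 M1y.
    by exists (k2 z) => //; exact: iso_fun i2 M2z.
  have [sM1 _ _] := ac_le_sub MM1; have [sM2 _ _] := ac_le_sub MM2.
  move=> Mx; have [e1 e2] := gE x Mx; split; exists x; rewrite /= ?k1E ?k2E //.
  + exact: sM1.
  + exact: sM2.
Qed.
End MonsterModel.

Theorem theorem3p17 (L : language) (U : Type)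
    (K : abstract_class L U) (LS lam : Type) (kappa theta : woset)
    (K' : abstract_class L U)
    (ind : structure L U -> U -> structure L U -> structure L U -> Prop) :
  (* the type of points is larger than lam *)
  ~~ ([set: U] #<= [set: lam]) ->
  abstract_elementary_class K ->
  LS_number K LS -> [set: LS] #<= [set: lam] ->
  stable_lam K lam -> amalgamation_lam K lam ->
  regular_cardinal kappa -> [set: kappa] #<= [set: lam] ->
  sub_abstract_class K' K ->
  (forall M, K_limit K lam kappa M -> K' M) ->
  (forall M, K' M -> K_lam K lam M) ->
  independence_relation K' ind ->
  weak_uniqueness K lam K' ind ->
  weak_extension K lam K' ind ->
  universal_continuity_star K lam K' ind ->
  local_character K lam K' ind kappa ->
  regular_cardinal theta -> [set: kappa] #<= [set: theta] ->
  [set: theta] #<= [set: lam] ->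
  weak_nonforking_amalgamation K lam K' ind theta ->
  forall M, K_limit K lam kappa M -> disjoint_amalgamation_base K M.
Proof.
move=> U_large aecK [[natLS _ _] _] LSlam stable amalg _ _ subK K'limit K'lam indP
  wuniq wext ucont locchar _ _ _ _ M KlM.
have lam_inf := card_le_trans natLS LSlam.
have K'M := K'limit M KlM.
have [I [_ [cf [lim Il [Ms [chM _]]]]]] := KlM.
(* Two members of the chain below [M] provide the models [M0] and [M1] that the construction of the
   monster starts from. *)
have [i0 _] := proj1 lim; have [i1 i01] := proj2 lim i0.
have [uMs uM _] := chM.
have [C [KC MC C_ext C_cover]] :=
  monster U_large aecK lam_inf amalg K'lam (uMs i0 i1 i01) (uM i1) K'M.
by apply: disjoint_amalgamation_limit; eassumption.
Qed.
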